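(* Let $1\le k\le m$. Let $A, C \subset [1\dots k]$ and $B, D \subset [1\dots m]$ be non-empty subsets with $|A|=|B|$ and $|C|=|D|$. Suppose that $I=S(A,B)$ and $J=S(C,D)$ are weakly separated subsets of $[1\dots m+k]$ satisfying condition (1) of the definition of weak separation, that is, $|I|\ge|J|$ and $J-I$ can be partitioned as $J-I=J'\sqcup J''$ with $J'\prec I-J\prec J''$. Then $$c\big(\Delta_{A,B}\,|\,\Delta_{C,D}\big)=|J''|-|J'|+|A|-|C|,$$ where $c(\Delta_{A,B}\,|\,\Delta_{C,D})$ is the integer $c$ with $\Delta_{C,D}\Delta_{A,B}=q^{c}\,\Delta_{A,B}\Delta_{C,D}$ in $\mathbb{C}_q[Mat_{k\times m}]$.
   Context: Notation: $[a\dots b]=\{a,a+1,\dots,b\}$; $X-Y$ denotes set difference. Quantum matrices: $\mathbb{C}_q[Mat_{k\times m}]$ ($k\le m$) is the unital $\mathbb{C}(q)$-algebra ($q$ an indeterminate) generated by $x_{i,j}$, $i\in[1\dots k]$, $j\in[1\dots m]$, subject to the relations: (i) $x_{s,t}x_{i,j}=q\,x_{i,j}x_{s,t}$ if either ($s>i$ and $t=j$) or ($s=i$ and $t>j$); (ii) $x_{s,t}x_{i,j}=x_{i,j}x_{s,t}$ if $s>i$ and $t<j$; (iii) $x_{s,t}x_{i,j}=x_{i,j}x_{s,t}+(q-q^{-1})x_{i,t}x_{s,j}$ if $s>i$ and $t>j$. Quantum minors: for non-empty $I=\{i_1<\dots<i_l\}\subset[1\dots k]$ and $J=\{j_1<\dots<j_l\}\subset[1\dots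 m]$ of the same size $l$, $\Delta_{I,J}=\sum_{\sigma\in S_l}(-q)^{-\ell(\sigma)}x_{i_1,j_{\sigma(1)}}\cdots x_{i_l,j_{\sigma(l)}}$, where $\ell(\sigma)$ is the length (number of inversions) of $\sigma$. Quasi-commutation: $\Delta_{A,B}$ and $\Delta_{C,D}$ quasi-commute if $\Delta_{C,D}\Delta_{A,B}=q^c\,\Delta_{A,B}\Delta_{C,D}$ for some integer $c$; this integer is then uniquely determined and is denoted $c(\Delta_{A,B}\,|\,\Delta_{C,D})$. The sets $S(A,B)$: for $A\subset[1\dots k]$, $B\subset[1\dots m]$ with $|A|=|B|$, $S(A,B)=\{b+k: b\in B\}\sqcup\big([1\dots k]-w_0(A)\big)$, a $k$-subset of $[1\dots k+m]$, where $w_0(a)=k+1-a$ is the order-reversing permutation of $[1\dots k]$. For sets of integers write $X\prec Y$ if $x<y$ for all $x\in X$, $y\in Y$ (vacuously true if one is empty). Subsets $I,J\subset[1\dots n]$ are weakly separated if at least one of the following holds: (1) $|I|\ge|J|$ and $J-I$ can be partitioned as $J-I=J'\sqcup J''$ with $J'\prec I-J\prec J''$; (2) $|J|\ge|I|$ and $I-J$ can be partitioned as $I-J=I'\sqcup I''$ with $I'\prec J-I\prec I''$. (The parts are allowed to be empty.) *)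

(* Defs.v *)
From HB Require Import structures.
From mathcomp Require Import all_boot all_order perm all_algebra.
From mathcomp Require Import boolp reals.
From mathcomp Require Import complex.

Set Implicit Arguments.
Unset Strict Implicit.
Unset Printing Implicit Defensive.
Import Order.TTheory GRing.Theory Num.Theory.
Local Open Scope quotient_scope.
Local Open Scope ring_scope.

(* 'I_k, 'I_m and 'I_(k + m) stand for [1..k], [1..m] and [1..k+m]: the
   ordinal of value v is the integer v + 1. *)

Section QuantumMatrices.
Variables (K : fieldType) (q : K) (k m : nat).

Record qmat_rel (A : algType K) (x : 'I_k -> 'I_m -> A) : Prop := QmatRel {
  qmat_col : forall (i s : 'I_k) (j : 'I_m), (i < s)%N ->
    x s j * x i j = q *: (x i j * x s j);
  qmat_row : forall (i : 'I_k) (j t : 'I_m), (j < t)%N ->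
    x i t * x i j = q *: (x i j * x i t);
  qmat_comm : forall (i s : 'I_k) (j t : 'I_m), (i < s)%N -> (t < j)%N ->
    x s t * x i j = x i j * x s t;
  qmat_cross : forall (i s : 'I_k) (j t : 'I_m), (i < s)%N -> (j < t)%N ->
    x s t * x i j = x i j * x s t + (q - q^-1) *: (x i t * x s j) }.

(* The algebra presented by the generators x_(i, j) and the relations
   [qmat_rel] is the set of noncommutative polynomial expressions, two of them
   being identified when the relations force them to be equal, i.e. when they
   agree in every algebra with a family of elements satisfying the relations.
   [qgen_rel], [qmat_lift] and [qmat_ind] below show that this is indeed the
   algebra with these generators and relations: it satisfies the relations, is
   generated by the x_(i, j), and maps to every other algebra with a family
   satisfying the relations. *)
Inductive qterm : Type :=
  | QScal of K
  | QGen of 'I_k & 'I_m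
  | QAdd of qterm & qterm
  | QMul of qterm & qterm.

Fixpoint qeval (A : algType K) (x : 'I_k -> 'I_m -> A) (t : qterm) : A :=
  match t with
  | QScal a => a%:A
  | QGen i j => x i j
  | QAdd u v => qeval x u + qeval x v
  | QMul u v => qeval x u * qeval x v
  end.

Definition qterm_eq (t u : qterm) : Prop :=
  forall (A : algType K) (x : 'I_k -> 'I_m -> A),
    qmat_rel x -> qeval x t = qeval x u.

HB.instance Definition _ := gen_eqMixin qterm.
HB.instance Definition _ := gen_choiceMixin qterm.

Definition qterm_eqb (t u : qterm) : bool := `[< qterm_eq t u >].

Lemma qterm_eqb_equiv : equiv_class_of qterm_eqb.
Proof.
split=> [t|t u|u t v].
- exact/asboolP.
- by apply/asboolP/asboolP => h A x hx; rewrite h.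
- by move=> /asboolP h1 /asboolP h2; apply/asboolP => A x hx; rewrite h1 ?h2.
Qed.

Canonical qterm_equiv := EquivRelPack qterm_eqb_equiv.

Definition qmat : Type := {eq_quot qterm_equiv}.
HB.instance Definition _ := Choice.on qmat.

Definition qmk (t : qterm) : qmat := \pi_({eq_quot qterm_equiv}) t.
Definition qrepr (a : qmat) : qterm := repr (a : {eq_quot qterm_equiv}).

Definition qmat_lift (A : algType K) (x : 'I_k -> 'I_m -> A) (a : qmat) : A :=
  qeval x (qrepr a).

Lemma qmat_lift_mk (A : algType K) (x : 'I_k -> 'I_m -> A) (t : qterm) :
  qmat_rel x -> qmat_lift x (qmk t) = qeval x t.
Proof.
move=> hx; have : qmk (qrepr (qmk t)) = qmk t by exact: reprK.
by move=> /eqquotP /asboolP; apply.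
Qed.

Lemma qmat_ext (a b : qmat) :
  (forall (A : algType K) (x : 'I_k -> 'I_m -> A), qmat_rel x ->
    qmat_lift x a = qmat_lift x b) -> a = b.
Proof.
move=> h; rewrite -[a](@reprK _ {eq_quot qterm_equiv}).
rewrite -[b](@reprK _ {eq_quot qterm_equiv}).
by apply/eqquotP/asboolP.
Qed.

Definition qmat_scal (c : K) : qmat := qmk (QScal c).
Definition qgen (i : 'I_k) (j : 'I_m) : qmat := qmk (QGen i j).
Definition qmat_add (a b : qmat) : qmat := qmk (QAdd (qrepr a) (qrepr b)).
Definition qmat_mul (a b : qmat) : qmat := qmk (QMul (qrepr a) (qrepr b)).
Definition qmat_scale (c : K) (a : qmat) : qmat := qmat_mul (qmat_scal c) a.
Definition qmat_opp (a : qmat) : qmat := qmat_scale (-1) a.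

Section LiftE.
Variables (A : algType K) (x : 'I_k -> 'I_m -> A) (hx : qmat_rel x).
Fact qmat_lift_scal c : qmat_lift x (qmat_scal c) = c%:A.
Proof. exact: qmat_lift_mk. Qed.
Lemma qmat_lift_gen i j : qmat_lift x (qgen i j) = x i j.
Proof. exact: qmat_lift_mk. Qed.
Fact qmat_lift_add a b :
  qmat_lift x (qmat_add a b) = qmat_lift x a + qmat_lift x b.
Proof. by rewrite qmat_lift_mk. Qed.
Fact qmat_lift_mul a b :
  qmat_lift x (qmat_mul a b) = qmat_lift x a * qmat_lift x b.
Proof. by rewrite qmat_lift_mk. Qed.
Fact qmat_lift_scale c a : qmat_lift x (qmat_scale c a) = c *: qmat_lift x a.
Proof. by rewrite qmat_lift_mul qmat_lift_scal mulr_algl. Qed.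
Fact qmat_lift_opp a : qmat_lift x (qmat_opp a) = - qmat_lift x a.
Proof. by rewrite qmat_lift_scale scaleN1r. Qed.
Definition qmat_liftE :=
  (qmat_lift_scale, qmat_lift_opp, qmat_lift_scal, qmat_lift_gen,
   qmat_lift_add, qmat_lift_mul).
End LiftE.

Fact qmat_addA : associative qmat_add.
Proof. by move=> a b c; apply: qmat_ext => A x h; rewrite !(qmat_liftE h) addrA. Qed.
Fact qmat_addC : commutative qmat_add.
Proof. by move=> a b; apply: qmat_ext => A x h; rewrite !(qmat_liftE h) addrC. Qed.
Fact qmat_add0 : left_id (qmat_scal 0) qmat_add.
Proof.
by move=> a; apply: qmat_ext => A x h; rewrite !(qmat_liftE h) scale0r add0r.
Qed.
Fact qmat_addN : left_inverse (qmat_scal 0) qmat_opp qmat_add.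
Proof.
by move=> a; apply: qmat_ext => A x h; rewrite !(qmat_liftE h) scale0r addNr.
Qed.
HB.instance Definition _ :=
  GRing.isZmodule.Build qmat qmat_addA qmat_addC qmat_add0 qmat_addN.

Fact qmat_mulA : associative qmat_mul.
Proof. by move=> a b c; apply: qmat_ext => A x h; rewrite !(qmat_liftE h) mulrA. Qed.
Fact qmat_mul1 : left_id (qmat_scal 1) qmat_mul.
Proof.
by move=> a; apply: qmat_ext => A x h; rewrite !(qmat_liftE h) scale1r mul1r.
Qed.
Fact qmat_mulr1 : right_id (qmat_scal 1) qmat_mul.
Proof.
by move=> a; apply: qmat_ext => A x h; rewrite !(qmat_liftE h) scale1r mulr1.
Qed.
Fact qmat_mulDl : left_distributive qmat_mul qmat_add.
Proof. by move=> a b c; apply: qmat_ext => A x h; rewrite !(qmat_liftE h) mulrDl. Qed.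
Fact qmat_mulDr : right_distributive qmat_mul qmat_add.
Proof. by move=> a b c; apply: qmat_ext => A x h; rewrite !(qmat_liftE h) mulrDr. Qed.
Fact qmat_1neq0 : qmat_scal 1 != 0.
Proof.
have h : qmat_rel (fun (_ : 'I_k) (_ : 'I_m) => 0 : K^o).
  by split=> *; rewrite !mulr0 ?(scaler0, addr0).
apply/eqP => /(congr1 (qmat_lift (fun _ _ => 0 : K^o))).
rewrite [RHS](qmat_liftE h) (qmat_liftE h) scale0r scale1r.
by move/eqP; rewrite oner_eq0.
Qed.
HB.instance Definition _ := GRing.Zmodule_isNzRing.Build qmat
  qmat_mulA qmat_mul1 qmat_mulr1 qmat_mulDl qmat_mulDr qmat_1neq0.

Fact qmat_scaleA c d a : qmat_scale c (qmat_scale d a) = qmat_scale (c * d) a.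
Proof. by apply: qmat_ext => A x h; rewrite !(qmat_liftE h) scalerA. Qed.
Fact qmat_scale1 : left_id 1 qmat_scale.
Proof. by move=> a; apply: qmat_ext => A x h; rewrite !(qmat_liftE h) scale1r. Qed.
Fact qmat_scaleDr : right_distributive qmat_scale +%R.
Proof. by move=> c a b; apply: qmat_ext => A x h; rewrite !(qmat_liftE h) scalerDr. Qed.
Fact qmat_scaleDl a : {morph qmat_scale^~ a : c d / c + d}.
Proof. by move=> c d; apply: qmat_ext => A x h; rewrite !(qmat_liftE h) scalerDl. Qed.
HB.instance Definition _ := GRing.Zmodule_isLmodule.Build K qmat
  qmat_scaleA qmat_scale1 qmat_scaleDr qmat_scaleDl.

Fact qmat_scaleAl (c : K) (a b : qmat) : c *: (a * b) = (c *: a) * b.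
Proof. by apply: qmat_ext => A x h; rewrite !(qmat_liftE h) scalerAl. Qed.
HB.instance Definition _ := GRing.Lmodule_isLalgebra.Build K qmat qmat_scaleAl.
Fact qmat_scaleAr (c : K) (a b : qmat) : c *: (a * b) = a * (c *: b).
Proof. by apply: qmat_ext => A x h; rewrite !(qmat_liftE h) scalerAr. Qed.
HB.instance Definition _ := GRing.Lalgebra_isAlgebra.Build K qmat qmat_scaleAr.

Lemma qgen_rel : qmat_rel (qgen : 'I_k -> 'I_m -> qmat).
Proof.
split=> [i s j lt|i j t lt|i s j t lt1 lt2|i s j t lt1 lt2];
  apply: qmat_ext => A x h; rewrite !(qmat_liftE h).
- exact: qmat_col.
- exact: qmat_row.
- exact: qmat_comm.
- exact: qmat_cross.
Qed.

Section Lift.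
Variables (A : algType K) (x : 'I_k -> 'I_m -> A) (hx : qmat_rel x).

Lemma qmat_liftD a b : qmat_lift x (a + b) = qmat_lift x a + qmat_lift x b.
Proof. exact: qmat_lift_add. Qed.
Lemma qmat_liftM a b : qmat_lift x (a * b) = qmat_lift x a * qmat_lift x b.
Proof. exact: qmat_lift_mul. Qed.
Lemma qmat_liftZ c a : qmat_lift x (c *: a) = c *: qmat_lift x a.
Proof. exact: qmat_lift_scale. Qed.
Lemma qmat_lift1 : qmat_lift x 1 = 1.
Proof. by rewrite [LHS]qmat_lift_scal // scale1r. Qed.
End Lift.

Lemma qmat_ind (P : qmat -> Prop) :
  (forall c : K, P c%:A) -> (forall i j, P (qgen i j)) ->
  (forall a b, P a -> P b -> P (a + b)) ->
  (forall a b, P a -> P b -> P (a * b)) -> forall a, P a.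
Proof.
move=> hS hG hD hM a; have <- : qmk (qrepr a) = a by exact: reprK.
elim: (qrepr a) => [c|i j|t ht u hu|t ht u hu].
- suff <- : c%:A = qmk (QScal c) by exact: hS.
  by apply: qmat_ext => A x h; rewrite qmat_liftZ // qmat_lift1 // qmat_lift_mk.
- exact: hG.
- suff <- : qmk t + qmk u = qmk (QAdd t u) by exact: hD.
  by apply: qmat_ext => A x h; rewrite qmat_liftD // !qmat_lift_mk.
- suff <- : qmk t * qmk u = qmk (QMul t u) by exact: hM.
  by apply: qmat_ext => A x h; rewrite qmat_liftM // !qmat_lift_mk.
Qed.

Definition perm_length (l : nat) (s : 'S_l) : nat :=
  #|[set p : 'I_l * 'I_l | (p.1 < p.2)%N && (s p.2 < s p.1)%N]|.

(* [enum_val] lists the elements of a set of ordinals in increasing order, and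
   the (noncommutative) product over r : 'I_#|I| is taken from left to right. *)
Definition qminor (I : {set 'I_k}) (J : {set 'I_m}) (eqIJ : #|I| = #|J|) : qmat :=
  \sum_(s : 'S_#|I|) (- q) ^- perm_length s *:
    \prod_(r < #|I|) qgen (enum_val r) (enum_val (cast_ord eqIJ (s r))).

End QuantumMatrices.

(* The field C(q), with C realised as R[i] for a model R of the reals. *)
Notation Cq R := {fraction {poly R[i]}}.
Notation qvar R := (tofrac 'X : Cq R).

Definition qcomm_exponent (K : fieldType) (q : K) (A : algType K)
  (X Y : A) (c : int) : Prop := Y * X = q ^ c *: (X * Y).

(* [lshift m] embeds [1..k] in [1..k+m], [rshift k] is b |-> b + k and
   [rev_ord] is a |-> k + 1 - a. *)
Definition Sset (k m : nat) (A : {set 'I_k}) (B : {set 'I_m}) : {set 'I_(k + m)} :=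
  [set rshift k b | b in B] :|:
  [set lshift m a | a in ~: [set rev_ord a | a in A]].

Definition set_prec (n : nat) (X Y : {set 'I_n}) : Prop :=
  forall x y, x \in X -> y \in Y -> (x < y)%N.

Definition weak_sep_split (n : nat) (I J J1 J2 : {set 'I_n}) : Prop :=
  [/\ (#|J| <= #|I|)%N, J :\: I = J1 :|: J2, [disjoint J1 & J2],
      set_prec J1 (I :\: J) & set_prec (I :\: J) J2].

Definition weakly_separated (n : nat) (I J : {set 'I_n}) : Prop :=
  (exists J1 J2, weak_sep_split I J J1 J2) \/
  (exists I1 I2, weak_sep_split J I I1 I2).

(* Main.v *)
Require Import Defs.
From HB Require Import structures.
From mathcomp Require Import all_boot all_order perm all_algebra.
From mathcomp Require Import reals.
From mathcomp Require Import complex.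
From mathcomp Require Import zify ring.
Import Order.TTheory GRing.Theory Num.Theory.
Local Open Scope ring_scope.

Set Implicit Arguments.
Unset Strict Implicit.
Unset Printing Implicit Defensive.

(* A skew letter family [xi] (with xi_j xi_i = - q^-1 xi_i xi_j for i < j) turns
   minors into coefficients: over letters commuting with x, the products of the
   rows X_r = \sum_j xi_j x_(r, j) are sums of the xi_J Delta_(I, J).  Two such
   families xi, eta with suitable exchange relations are reproduced by X and
   Y_r = \sum_j eta_j x_(r, j).  If R1 - R2 < R2 - R1, then
   Y_(R1) X_(R2) = q^|R1 :&: R2| X_(R2) Y_(R1), because a common index can be
   pulled out of both products; if moreover Q2 - Q1 < Q1 - Q2, comparing
   coefficients gives the commutation of Delta_(R1, Q1) and Delta_(R2, Q2).
   A weakly separated pair with B - D and C - A nonempty is of this form.  If B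
   is contained in D, the rows A split at C - A into a low and a high part, and
   Delta_(A, B) is a sum of products of minors on these parts, each of which
   commutes with Delta_(C, D) up to a constant power of q; the case of C
   contained in A follows by transposition.
   The exponent is unique because the product of two minors is nonzero: an
   elementary row operation with q-commuting coefficients sends it to one whose
   leading coefficient is the product of the minors on lowered rows, so one may
   descend to leading minors, evaluated at the identity matrix. *)

(** * Products of skew letters *)

Section Letters.
Variables (K : fieldType) (q : K).
Hypothesis q0 : q != 0.

(** Equality up to a nonzero scalar: reordering letters costs only such a factor, and in most
    arguments the same factor appears on both sides and cancels. *)
Definition propto (E : lmodType K) (u v : E) := exists2 c : K, c != 0 & u = c *: v.

Lemma propto_refl (E : lmodType K) (u : E) : propto u u.
Proof. by exists 1; rewrite ?oner_neq0 ?scale1r. Qed.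

Lemma propto_trans (E : lmodType K) (u v w : E) :
  propto u v -> propto v w -> propto u w.
Proof.
by move=> [c c0 ->] [d d0 ->]; exists (c * d); rewrite ?mulf_neq0 ?scalerA.
Qed.

Lemma propto_sym (E : lmodType K) (u v : E) : propto u v -> propto v u.
Proof.
by move=> [c c0 ->]; exists c^-1; rewrite ?invr_neq0 // scalerA mulVf // scale1r.
Qed.

Lemma proptoM (E : algType K) (u u' v v' : E) :
  propto u v -> propto u' v' -> propto (u * u') (v * v').
Proof.
move=> [c c0 ->] [d d0 ->]; exists (c * d); rewrite ?mulf_neq0 //.
by rewrite -scalerAl -scalerAr scalerA.
Qed.

Lemma propto0 (E : lmodType K) (u : E) : propto u 0 -> u = 0.
Proof. by move=> [c _ ->]; rewrite scaler0. Qed.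

Section Skew.
Variables (E : algType K) (n : nat).
Implicit Types (xi eta : 'I_n -> E) (s t : seq 'I_n).

Definition lprod xi s : E := \prod_(i <- s) xi i.

Lemma lprod_nil xi : lprod xi [::] = 1. Proof. exact: big_nil. Qed.
Lemma lprod_cons xi i s : lprod xi (i :: s) = xi i * lprod xi s.
Proof. exact: big_cons. Qed.
Lemma lprod_cat xi s t : lprod xi (s ++ t) = lprod xi s * lprod xi t.
Proof. exact: big_cat. Qed.
Lemma lprod_rcons xi s i : lprod xi (rcons s i) = lprod xi s * xi i.
Proof. by rewrite -cats1 lprod_cat /lprod big_seq1. Qed.

(** The relations of a quantum exterior algebra. *)
Definition qskew xi : Prop :=
  (forall i, xi i * xi i = 0) /\
  (forall i j : 'I_n, (i < j)%N -> xi j * xi i = - q^-1 *: (xi i * xi j)).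

Lemma skew_swap xi i j : qskew xi -> propto (xi i * xi j) (xi j * xi i).
Proof.
move=> [sq sw]; have nq : - q^-1 != 0 by rewrite oppr_eq0 invr_neq0.
case: (ltngtP i j) => [lt|lt|/val_inj ->]; last exact: propto_refl.
  by apply: propto_sym; exists (- q^-1) => //; rewrite sw.
by exists (- q^-1) => //; rewrite sw.
Qed.

Lemma lprod_swap xi i s : qskew xi -> propto (xi i * lprod xi s) (lprod xi s * xi i).
Proof.
move=> sk; elim: s => [|j s IH]; first by rewrite lprod_nil mul1r mulr1; exact: propto_refl.
rewrite lprod_cons mulrA -(mulrA (xi j)).
apply: propto_trans (proptoM (propto_refl (xi j)) IH); rewrite mulrA.
exact: proptoM (skew_swap _ _ sk) (propto_refl _).
Qed.

Lemma lprod_perm xi s t : qskew xi -> perm_eq s t -> propto (lprod xi s) (lprod xi t).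
Proof.
move=> sk; elim: s t => [|i s IH] t.
  by rewrite perm_sym => /perm_nilP ->; exact: propto_refl.
move=> pst; have /splitPr it : i \in t by rewrite -(perm_mem pst) mem_head.
case: it pst => t1 t2 pst; have {}pst : perm_eq s (t1 ++ t2).
  rewrite -(perm_cons i); apply: perm_trans pst _.
  by rewrite perm_catC /= perm_cons perm_catC.
rewrite lprod_cons lprod_cat lprod_cons mulrA.
apply: propto_trans (proptoM (propto_refl _) (IH _ pst)) _.
rewrite lprod_cat mulrA; apply: proptoM (propto_refl _).
exact: lprod_swap.
Qed.

Lemma lprod_dup xi s : qskew xi -> ~~ uniq s -> lprod xi s = 0.
Proof.
move=> sk; elim: s => [//|i s IH] /=; rewrite negb_and negbK lprod_cons.
case/orP => [/splitPr|/IH ->]; last by rewrite mulr0.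
case=> t1 t2; rewrite lprod_cat lprod_cons !mulrA; apply: propto0.
(* The zero is expanded into [lprod xi t1 * (xi i * xi i) * lprod xi t2], so it remains only to move
   one [xi i] past [t1]. *)
rewrite -(mul0r (lprod xi t2)) -(mulr0 (lprod xi t1)) -(sk.1 i) mulrA.
by do 2!apply: proptoM (propto_refl _) => //; exact: lprod_swap.
Qed.

Lemma lprod_eq0_meet xi s t i :
  qskew xi -> i \in s -> i \in t -> lprod xi s * lprod xi t = 0.
Proof.
move=> sk si ti; rewrite -lprod_cat; apply: lprod_dup => //.
by rewrite cat_uniq !negb_and; apply/orP; right; apply/orP; left; rewrite negbK; apply/hasP;
  exists i.
Qed.

End Skew.
End Letters.

(** * Exchange and separation for two families of letters *)

Section LetterPair.
Variables (K : fieldType) (q : K).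
Hypothesis q0 : q != 0.
Variables (E : algType K) (n : nat).

(** Within a family the letters are skew. Between the families, [lp_diag], [lp_lt] and [lp_gt] copy
    the relations [qmat_col], [qmat_comm] and [qmat_cross] of a matrix row [xi] and a later row
    [eta]. *)
Record letter_pair (xi eta : 'I_n -> E) : Prop := LetterPair {
  lp_xi : qskew q xi;
  lp_eta : qskew q eta;
  lp_diag : forall i, eta i * xi i = q *: (xi i * eta i);
  lp_lt : forall i j : 'I_n, (i < j)%N -> eta i * xi j = xi j * eta i;
  lp_gt : forall i j : 'I_n, (i < j)%N ->
    eta j * xi i = xi i * eta j + (q - q^-1) *: (xi j * eta i) }.

Variables (xi eta : 'I_n -> E).
Hypothesis lp : letter_pair xi eta.
Let skx : qskew q xi := lp_xi lp.
Let ske : qskew q eta := lp_eta lp.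
Implicit Types (i j : 'I_n) (s t : seq 'I_n).

(** Moving [eta i] past [xi d] may create the correction term of [lp_gt], but it begins with a
    second [xi i] and dies. [lp_push] is the mirror image, with a second [eta i]. *)
Lemma lp_pull i d : xi i * eta i * xi d = xi i * xi d * eta i.
Proof.
case: (ltngtP i d) => [lt|lt|/val_inj ->].
- by rewrite -mulrA (lp_lt lp) // mulrA.
- rewrite -mulrA (lp_gt lp) // mulrDr mulrA -scalerAr mulrA skx.1 mul0r scaler0.
  by rewrite addr0.
- by rewrite -mulrA (lp_diag lp) -scalerAr mulrA skx.1 mul0r scaler0.
Qed.

Lemma lp_push i j : eta j * xi i * eta i = xi i * eta j * eta i.
Proof.
case: (ltngtP i j) => [lt|lt|/val_inj ->].
- rewrite (lp_gt lp) // mulrDl -scalerAl -(mulrA (xi j)) ske.1 mulr0 scaler0.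
  by rewrite addr0.
- by rewrite (lp_lt lp).
- by rewrite (lp_diag lp) -scalerAl -mulrA ske.1 mulr0 scaler0.
Qed.

Lemma lprod_pull i s :
  xi i * eta i * lprod xi s = xi i * lprod xi s * eta i.
Proof.
elim/last_ind: s => [|s d IH]; first by rewrite lprod_nil !mulr1.
rewrite lprod_rcons mulrA IH mulrA.
have [c c0 e] := lprod_swap q0 i s skx.
rewrite e -!scalerAl; congr (_ *: _).
by rewrite -!(mulrA (lprod xi s)) lp_pull.
Qed.

Lemma lprod_push i s :
  lprod eta s * xi i * eta i = xi i * lprod eta s * eta i.
Proof.
elim: s => [|d s IH]; first by rewrite lprod_nil mul1r mulr1.
rewrite lprod_cons -!mulrA [X in _ * X]mulrA IH !mulrA.
have [c c0 e] := propto_sym (lprod_swap q0 i s ske).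
by rewrite -!(mulrA _ (lprod eta s)) e -!scalerAr !mulrA lp_push.
Qed.

(* A common letter [i] is bubbled to the middle, where [eta_i xi_i = q xi_i eta_i]
   can be pulled out of both products. *)
Lemma lprod_exchange s t : uniq s -> uniq t ->
  (forall i j, i \in s -> i \notin t -> j \in t -> j \notin s -> (i < j)%N) ->
  lprod eta s * lprod xi t = q ^+ count (mem t) s *: (lprod xi t * lprod eta s).
Proof.
move: {2}(size s) (leqnn (size s)) => m; elim: m s t => [|m IH] s t.
  by rewrite leqn0 => /nilP -> _ _ _ ; rewrite lprod_nil mul1r mulr1 scale1r.
move=> sz us ut lt; case: (boolP (has (mem t) s)) => [|nst]; last first.
  have -> : count (mem t) s = 0 by move: nst; rewrite has_count lt0n negbK => /eqP.
  have {}nst i : i \in s -> i \notin t.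
    by move=> si; apply: contra nst => ti; apply/hasP; exists i.
  (* Without a common letter, the hypothesis puts all of [s] before all of [t], and [lp_lt] makes
     the letters commute. *)
  have {}lt i j : i \in s -> j \in t -> eta i * xi j = xi j * eta i.
    move=> si tj; apply: (lp_lt lp); apply: lt => //; first exact: nst.
    by apply/negP => /nst; rewrite tj.
  rewrite scale1r; change (GRing.comm (lprod eta s) (lprod xi t)).
  rewrite [X in GRing.comm _ X]/lprod big_seq; apply: commr_prod => j tj.
  apply: commr_sym; rewrite [X in GRing.comm _ X]/lprod big_seq.
  by apply: commr_prod => i si; apply: commr_sym; exact: lt.
case/hasP => i si /= ti.
have ps : perm_eq s (rcons (rem i s) i) by rewrite perm_sym perm_rcons perm_sym perm_to_rem.
have pt : perm_eq t (i :: rem i t) by exact: perm_to_rem.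
have [c c0 es] := lprod_perm q0 ske ps.
have [d d0 et] := lprod_perm q0 skx pt.
have -> : count (mem t) s = (count (mem (rem i t)) (rem i s)).+1.
  rewrite (seq.permP ps) -cats1 count_cat /= ti addn0 addn1; congr S.
  apply: eq_in_count => j; rewrite (rem_filter _ us) mem_filter => /andP[/= ji _].
  by rewrite (rem_filter _ ut) mem_filter /= ji.
have {}IH := IH (rem i s) (rem i t).
rewrite {}es {}et lprod_rcons lprod_cons -!scalerAl -!scalerAr !scalerA.
rewrite (_ : _ * d * c = c * d * q ^+ (count (mem (rem i t)) (rem i s)).+1); last by ring.
rewrite exprSr -scalerA -[RHS]scalerA -scalerA; congr (_ *: (_ *: _)); rewrite -scalerA.
set S := rem i s in IH *; set T := rem i t in IH *.
have {}IH : lprod eta S * lprod xi T = q ^+ count (mem T) S *: (lprod xi T * lprod eta S).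
  apply: IH; rewrite ?rem_uniq //.
    by rewrite size_rem // -ltnS prednK //; case: (s) si.
  move=> a b; rewrite /S /T !rem_filter // !mem_filter /= !negb_and !negbK.
  by move=> /andP[ai sa] /orP[/eqP ea|ta] /andP[bi tb] /orP[/eqP eb|sb]; 
    rewrite ?ea ?eb ?eqxx in ai bi *; apply: lt.
have [k k0 e] := propto_sym (lprod_swap q0 i S ske).
rewrite scalerA [_ * q]mulrC -scalerA.
rewrite mulrA -(mulrA _ (eta i)) (lp_diag lp) -scalerAr -scalerAl; congr (_ *: _).
rewrite mulrA lprod_push -(mulrA (xi i)) e -scalerAr -scalerAl mulrA -(mulrA _ _ (lprod xi T)).
rewrite IH -scalerAr mulrA lprod_pull scalerA mulrC -scalerA; congr (_ *: _).
by rewrite -scalerAr !mulrA.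
Qed.

End LetterPair.

Section Separation.
Variables (K : fieldType) (q : K).
Hypothesis q0 : q != 0.
Variables (E : algType K) (n : nat) (xi eta : 'I_n -> E).
Hypothesis lp : letter_pair q xi eta.
Let skx : qskew q xi := lp_xi lp.
Let ske : qskew q eta := lp_eta lp.
Implicit Types (i j : 'I_n) (s t a c g h : seq 'I_n).

(** By [lprod_exchange] the products over [g] and [a] commute up to a power of [q], which brings
    [xi j] next to the product that already contains it. *)
Lemma lprod_absorb g a j : uniq g -> uniq a ->
  (forall i j, i \in a -> i \notin g -> j \in g -> (i < j)%N) -> j \in g ->
  lprod xi g * lprod eta a * xi j = 0.
Proof.
move=> ug ua lt gj.
have e := lprod_exchange q0 lp ua ug (fun i j si ti tj _ => lt i j si ti tj).
have qe : q ^+ count (mem g) a != 0 by rewrite expf_neq0.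
apply: (scalerI qe); rewrite scaler0 scalerAl -e -mulrA.
by rewrite -[xi j]mulr1 -(lprod_nil xi) -lprod_cons (lprod_eq0_meet q0 skx gj) ?mem_head ?mulr0.
Qed.

(** The adjacent pair [eta i * xi i] equals [q] times [xi i * eta i]. On both sides this pair can be
    pulled to the far left, with the same scalars, which leaves the hypothesis. *)
Lemma separate_step i g a c h (l : K) :
  lprod xi g * lprod eta a * lprod xi c * lprod eta h =
    l *: (lprod xi g * lprod xi c * lprod eta a * lprod eta h) ->
  lprod xi g * lprod eta (rcons a i) * lprod xi (i :: c) * lprod eta h =
    (q * l) *: (lprod xi g * lprod xi (i :: c) * lprod eta (rcons a i) * lprod eta h).
Proof.
move=> IH; have [k k0 ek] := propto_sym (lprod_swap q0 i a ske).
have [d d0 ed] := propto_sym (lprod_swap q0 i g skx).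
rewrite lprod_rcons lprod_cons !mulrA.
rewrite -(mulrA _ (eta i) (xi i)) (lp_diag lp) -!scalerAr -!scalerAl -scalerA; congr (_ *: _).
have ep : lprod eta a * (xi i * eta i) = k *: (xi i * eta i * lprod eta a).
  by rewrite mulrA (lprod_push q0 lp) -(mulrA (xi i)) ek -scalerAr mulrA.
have eg : lprod xi g * (xi i * eta i) = d *: (xi i * eta i * lprod xi g).
  by rewrite mulrA ed -scalerAl -(lprod_pull q0 lp).
rewrite -(mulrA (lprod xi g) (lprod eta a)) ep -scalerAr mulrA eg ed.
rewrite -(mulrA _ (lprod eta a) (eta i)) ek.
rewrite -!(scalerAl, scalerAr) !scalerA.
rewrite (mulrC l) -[RHS]scalerA; congr (_ *: _).
rewrite -!(mulrA (xi i * eta i)) IH -scalerAr; congr (_ *: _).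
by rewrite -lprod_cat !mulrA (lprod_pull q0 lp) lprod_cat !mulrA.
Qed.

(** If [c] meets [g], both sides vanish. Otherwise counting forces [c] to have the elements of [h]
    and [a] to lie in [g]; moving a letter of [c] past [eta j] with [j] in [g] creates a correction
    term containing [xi j], which [lprod_absorb] kills. *)
Lemma separate_base g h a c : uniq g -> uniq (a ++ c) ->
  {subset a ++ c <= g ++ h} -> size a = size g -> size c = size h ->
  (forall i j, i \in h -> j \in g -> (i < j)%N) ->
  lprod xi g * lprod eta a * lprod xi c = lprod xi g * lprod xi c * lprod eta a.
Proof.
move=> ug; rewrite cat_uniq => /and3P[ua dac uc] sub sza szc lt.
have gz b j : uniq b -> {subset b <= g ++ h} -> j \in g ->
    lprod xi g * lprod eta b * xi j = 0.
  move=> ub sb gj; apply: lprod_absorb => // i i' bi gi gi'; apply: lt => //.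
  by have := sb _ bi; rewrite mem_cat (negPf gi).
have asub : {subset a <= g ++ h} by move=> i ai; apply: sub; rewrite mem_cat ai.
case: (boolP (has (mem c) g)) => [/hasP[i gi /= ci]|ngc].
  have [k k0 ->] := lprod_perm q0 skx (perm_to_rem ci).
  rewrite lprod_cons -!scalerAr mulrA gz // mul0r scaler0.
  by rewrite mulrA -[xi i]mulr1 -(lprod_nil xi) -lprod_cons (lprod_eq0_meet q0 skx gi)
    ?mem_head // !mul0r scaler0 mul0r.
have {}ngc i : i \in c -> i \notin g.
  by move=> ci; apply: contra ngc => gi; apply/hasP; exists i.
have csub : {subset c <= h}.
  by move=> i ci; have := sub i; rewrite !mem_cat ci orbT (negPf (ngc _ ci)); apply.
have [_ ech] := uniq_min_size uc csub (eq_leq (esym szc)).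
have {}asub : {subset a <= g}.
  move=> i ai; have := asub i ai; rewrite mem_cat => /orP[//|]; rewrite -ech => ci.
  by case/hasP: dac; exists i.
have main i b : uniq b -> {subset b <= g} -> i \in h ->
    lprod xi g * lprod eta b * xi i = lprod xi g * xi i * lprod eta b.
  elim/last_ind: b => [|b j IH]; first by rewrite lprod_nil !mulr1.
  rewrite rcons_uniq => /andP[jb ub] sb hi;
    have gj : j \in g by rewrite sb // mem_rcons mem_head.
  have {}sb : {subset b <= g} by move=> k bk; rewrite sb // mem_rcons inE bk orbT.
  rewrite lprod_rcons mulrA -mulrA (lp_gt lp) ?lt // mulrDr -scalerAr !mulrA.
  by rewrite (gz b j) ?mul0r ?scaler0 ?addr0 ?IH // => k /sb; rewrite mem_cat => ->.
elim: c csub {uc dac szc ngc ech sub} => [|i c IH] csub; first by rewrite lprod_nil !mulr1.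
rewrite lprod_cons !mulrA main //; last by rewrite csub ?mem_head.
have [k k0 ek] := propto_sym (lprod_swap q0 i g skx).
rewrite ek -!scalerAl; congr (_ *: _).
rewrite -!mulrA; congr (_ * _); rewrite !mulrA IH // => j cj.
by rewrite csub // inE cj orbT.
Qed.

(* Multiplication by xi_g and eta_h extracts the coefficient of xi_(Q2) eta_(Q1):
   all other products xi_C eta_A with letters in Q1 :|: Q2 are killed. *)
Lemma lprod_separate (Q1 Q2 A C : {set 'I_n}) :
  #|A| = #|Q1| -> #|C| = #|Q2| -> A \subset Q1 :|: Q2 -> C \subset Q1 :|: Q2 ->
  (forall i j, i \in Q2 :\: Q1 -> j \in Q1 :\: Q2 -> (i < j)%N) ->
  let g := enum (Q1 :\: Q2) in let h := enum (Q2 :\: Q1) in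
  lprod xi g * lprod eta (enum A) * lprod xi (enum C) * lprod eta h =
  q ^+ #|Q1 :&: Q2| *:
    (lprod xi g * lprod xi (enum C) * lprod eta (enum A) * lprod eta h).
Proof.
move=> cA cC sA sC lt g h; set S := Q1 :&: Q2.
(* A letter common to [A] and [C] but not to [Q1] and [Q2] occurs again in [g] or in [h], so both
   sides vanish. *)
case: (boolP (A :&: C \subset S)) => [sS|nsS]; last first.
  have [ i ] := subsetPn nsS; rewrite !inE negb_and => /andP[iA iC] niS.
  have := subsetP sA i iA; rewrite inE => iQ.
  have [c c0 ec] : propto (lprod eta (enum A)) (lprod eta (rcons (rem i (enum A)) i)).
    apply: (lprod_perm q0 ske); rewrite perm_sym perm_rcons perm_sym perm_to_rem //.
    by rewrite mem_enum.
  have [d d0 ed] : propto (lprod xi (enum C)) (lprod xi (i :: rem i (enum C))).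
    by apply: (lprod_perm q0 skx); rewrite perm_to_rem // mem_enum.
  have iAe : i \in enum A by rewrite mem_enum.
  have iCe : i \in enum C by rewrite mem_enum.
  have bub : lprod eta (enum A) * lprod xi (enum C) = (c * d * q) *:
      (lprod eta (rem i (enum A)) * (xi i * eta i) * lprod xi (rem i (enum C))).
    rewrite ec ed lprod_rcons lprod_cons -!(scalerAl, scalerAr) scalerA.
    rewrite -[in LHS]mulrA [in LHS](mulrA (eta i)) (lp_diag lp) -!(scalerAl, scalerAr) scalerA.
    by rewrite !mulrA.
  rewrite -(mulrA (lprod xi g)) bub -!(scalerAl, scalerAr).
  case: (boolP (i \in Q1)) niS iQ => [iQ1 /= iQ2 _|iQ1 _ /= iQ2].
    have ig : i \in g by rewrite mem_enum !inE iQ1 iQ2.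
    rewrite (lprod_eq0_meet q0 skx ig iCe) !mul0r scaler0.
    rewrite mulrA (lprod_push q0 lp) !mulrA -[xi i]mulr1 -(lprod_nil xi) -lprod_cons.
    by rewrite (lprod_eq0_meet q0 skx ig) ?mem_head // !mul0r scaler0.
  have ih : i \in h by rewrite mem_enum !inE iQ1 iQ2.
  rewrite -(mulrA _ (lprod eta (enum A))) (lprod_eq0_meet q0 ske iAe ih) mulr0 scaler0.
  rewrite -(mulrA _ (xi i * eta i)) (lprod_pull q0 lp) -!mulrA.
  rewrite -[eta i]mulr1 -(lprod_nil eta) -lprod_cons.
  by rewrite (lprod_eq0_meet q0 ske _ ih) ?mem_head // !mulr0 scaler0.
(* Since [A :|: C] lies in [Q1 :|: Q2], counting bounds [A :&: C] from below, so the common letters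
   are exactly [S]. *)
have eU : #|Q1 :|: Q2| = (#|Q1| + #|Q2| - #|S|)%N by rewrite cardsU.
have leU : (#|A :|: C| <= #|Q1 :|: Q2|)%N by apply: subset_leq_card; rewrite subUset sA.
have leS : (#|S| <= #|Q1|)%N by rewrite subset_leq_card ?subsetIl.
have leAC := subset_leq_card sS.
have eS : A :&: C = S.
  apply/eqP; rewrite eqEcard sS /=; move: leU; rewrite eU cardsU cA cC.
  by move: leAC leS; rewrite /S; move: #|Q1| #|Q2| #|_| #|_| => a b c d; lia.
have [c c0 ec] : propto (lprod eta (enum A)) (lprod eta (enum (A :\: S) ++ enum S)).
  apply: (lprod_perm q0 ske); apply: uniq_perm; rewrite ?enum_uniq //.
    rewrite cat_uniq !enum_uniq /= andbT; apply/hasPn => i.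
    by rewrite /= !mem_enum in_setD => ->.
  move=> i; rewrite mem_cat !mem_enum in_setD -eS inE.
  by case: (i \in A) => //; case: (i \in C).
have [d d0 ed] : propto (lprod xi (enum C)) (lprod xi (rev (enum S) ++ enum (C :\: S))).
  apply: (lprod_perm q0 skx); apply: uniq_perm; rewrite ?enum_uniq //.
    rewrite cat_uniq rev_uniq !enum_uniq /= andbT; apply/hasPn => i.
    by rewrite /= mem_rev !mem_enum in_setD => /andP[].
  move=> i; rewrite mem_cat mem_rev !mem_enum in_setD -eS inE.
  by case: (i \in C) => //; rewrite ?andbF ?andbT //; case: (i \in A).
have base : lprod xi g * lprod eta (enum (A :\: S)) * lprod xi (enum (C :\: S)) * lprod eta h =
    1 *: (lprod xi g * lprod xi (enum (C :\: S)) * lprod eta (enum (A :\: S)) * lprod eta h).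
  rewrite scale1r (separate_base (h := h)) ?enum_uniq //.
  - rewrite cat_uniq !enum_uniq /= andbT; apply/hasPn => i.
    by rewrite /= !mem_enum -eS !inE; case: (i \in C) => //; case: (i \in A).
  - move=> i; rewrite !mem_cat !mem_enum !inE.
    by move=> /orP[/andP[iS /(subsetP sA)]|/andP[iS /(subsetP sC)]]; move: iS; rewrite !inE;
      case: (i \in Q1); case: (i \in Q2).
  - have -> : A :\: S = A :\: C by rewrite -eS setDIr setDv set0U.
    by rewrite -!cardE !cardsD eS cA.
  - have -> : C :\: S = C :\: A by rewrite -eS setDIr setDv setU0.
    by rewrite -!cardE !cardsD setIC eS cC (setIC Q2).
  - by move=> i j; rewrite !mem_enum; exact: lt.
(* The common letters end the [eta] product and, reversed, begin the [xi] product: they form nested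
   pairs, and [separate_step] adds them one at a time with a factor [q] each. *)
have bubble s l a b :
    lprod xi g * lprod eta a * lprod xi b * lprod eta h =
      l *: (lprod xi g * lprod xi b * lprod eta a * lprod eta h) ->
    lprod xi g * lprod eta (a ++ s) * lprod xi (rev s ++ b) * lprod eta h =
      (q ^+ size s * l) *:
      (lprod xi g * lprod xi (rev s ++ b) * lprod eta (a ++ s) * lprod eta h).
  elim: s l a b => [|i s IH] l a b e; first by rewrite cats0 mul1r.
  rewrite rev_cons -cat_rcons cat_rcons -cats1 -catA /= -(cat1s i s) catA cats1.
  by rewrite (IH (q * l)) ?exprSr ?mulrA //; exact: separate_step.
rewrite ec ed -!(scalerAl, scalerAr) (bubble _ _ _ _ base) mulr1 -cardE.
by rewrite !scalerA; congr (_ *: _); ring.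
Qed.

End Separation.

(** The quadratic relations mix only the terms of index (i, j) and (j, i), so double sums are
    compared on unordered pairs. *)
Lemma sum_pairs (V : zmodType) (n : nat) (f : 'I_n -> 'I_n -> V) :
  \sum_i \sum_j f i j =
    \sum_i f i i + \sum_(i : 'I_n) \sum_(j : 'I_n | (i < j)%N) (f i j + f j i).
Proof.
rewrite -big_split /=.
transitivity (\sum_(i : 'I_n) (f i i + \sum_(j : 'I_n | (i < j)%N) f i j +
                      \sum_(j : 'I_n | (j < i)%N) f i j)).
  apply: eq_bigr => i _; rewrite (bigD1 i) //= -addrA; congr (_ + _).
  rewrite (bigID (fun j : 'I_n => (i < j)%N)) /=; congr (_ + _); apply: eq_bigl => j.
    by rewrite -val_eqE /=; case: ltngtP.
  by rewrite -val_eqE /=; case: ltngtP.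
rewrite [LHS]big_split /= (exchange_big_dep predT) //= -big_split /=.
apply: eq_bigr => i _; rewrite -addrA; congr (_ + _).
by rewrite -big_split.
Qed.

(** * Rows with skew letters as coefficients *)

Section RowSum.
Variables (K : fieldType) (q : K).
Hypothesis q0 : q != 0.
Variables (A E : algType K) (iota : {lrmorphism A -> E}) (k m : nat).
Variable x : 'I_k -> 'I_m -> A.
Hypothesis hx : qmat_rel q x.

Definition rowsum (xi : 'I_m -> E) (r : 'I_k) : E := \sum_j xi j * iota (x r j).

Definition central_letters (xi : 'I_m -> E) : Prop :=
  forall j a, xi j * iota a = iota a * xi j.

Lemma rowsumM xi eta r s : central_letters eta ->
  rowsum xi r * rowsum eta s =
    \sum_i \sum_j xi i * eta j * iota (x r i * x s j).
Proof.
move=> ce; rewrite /rowsum mulr_suml; apply: eq_bigr => i _.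
rewrite mulr_sumr; apply: eq_bigr => j _.
by rewrite rmorphM -!mulrA; congr (_ * _); rewrite !mulrA ce.
Qed.

(** This is the coaction of quantum matrices on the quantum exterior algebra: the row sums are again
    skew letters, now indexed by rows. *)
Lemma qskew_rowsum xi : qskew q xi -> central_letters xi -> qskew q (rowsum xi).
Proof.
move=> [sq sw] ce; split=> [r|r s rs]; rewrite !rowsumM //.
  rewrite sum_pairs !big1 ?addr0 // => [i _|i _]; last by rewrite sq mul0r.
  rewrite big1 // => j ij; rewrite (sw _ _ ij) (qmat_row hx r ij).
  by rewrite linearZ -!(scalerAl, scalerAr) scalerA mulNr mulVf // scaleN1r addrN.
rewrite !sum_pairs scalerDr !scaler_sumr -!big_split; apply: eq_bigr => i _ /=.
rewrite !sq !mul0r scaler0 !add0r scaler_sumr; apply: eq_bigr => j ij.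
rewrite (sw _ _ ij) (qmat_cross hx rs ij) (qmat_comm hx rs ij).
rewrite linearD linearZ /= !(scalerDr, mulrDr) -!(scalerAl, scalerAr) !scalerA.
rewrite addrCA; congr (_ + _).
rewrite -{1}[xi i * xi j * _]scale1r -scalerDl; congr (_ *: _).
by field.
Qed.

(** All results on letter pairs thereby apply with rows in place of columns. Each relation is
    checked on the diagonal terms and on each pair i < j separately. *)
Lemma letter_pair_rowsum xi eta : letter_pair q xi eta ->
  central_letters xi -> central_letters eta ->
  letter_pair q (rowsum xi) (rowsum eta).
Proof.
move=> lp cx ce; split;
  [exact: qskew_rowsum (lp_xi lp) cx|exact: qskew_rowsum (lp_eta lp) ce|..].
- move=> r; rewrite !rowsumM // !sum_pairs scalerDr !scaler_sumr.
  congr (_ + _); apply: eq_bigr => i _; first by rewrite (lp_diag lp) -scalerAl.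
  rewrite scaler_sumr; apply: eq_bigr => j ij.
  rewrite (lp_lt lp) // (lp_gt lp) // (qmat_row hx r ij) !linearZ /= -!scalerAr.
  rewrite mulrDl -!scalerAl !scalerDr addrCA !scalerA; congr (_ + _).
  by rewrite -{1}[xi j * eta i * _]scale1r -scalerDl; congr (_ *: _); field.
- move=> r s rs; rewrite !rowsumM // !sum_pairs.
  congr (_ + _); apply: eq_bigr => i _.
    by rewrite (lp_diag lp) (qmat_col hx i rs) linearZ -scalerAl -scalerAr.
  apply: eq_bigr => j ij.
  rewrite (lp_lt lp) // (lp_gt lp) // (qmat_cross hx rs ij) (qmat_comm hx rs ij).
  rewrite linearD linearZ /= mulrDr mulrDl -!(scalerAl, scalerAr) addrCA addrA addrAC.
  by rewrite -addrA.
- move=> r s rs; rewrite !rowsumM // !sum_pairs scalerDr !scaler_sumr addrACA -!big_split.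
  apply: eq_bigr => i _ /=; congr (_ + _).
    rewrite (lp_diag lp) (qmat_col hx i rs) linearZ -!(scalerAl, scalerAr) !scalerA.
    by rewrite -{2}[xi i * eta i * _]scale1r -scalerDl; congr (_ *: _); field.
  rewrite scaler_sumr -big_split; apply: eq_bigr => j ij /=.
  rewrite (lp_lt lp) // (lp_gt lp) // (qmat_cross hx rs ij) (qmat_comm hx rs ij).
  rewrite linearD linearZ /= !(scalerDr, mulrDr, mulrDl) -!(scalerAl, scalerAr) !scalerA.
  rewrite ?addrA; congr (_ + _); rewrite addrAC; congr (_ + _ + _); exact: addrC.
Qed.

End RowSum.

(** * Minors as coefficients of letter products *)

Section Inversions.
Variables (K : fieldType) (q : K) (E : algType K) (n : nat).
Variables (xi : 'I_n -> E).
Hypothesis skx : qskew q xi.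

Fixpoint seq_inv (s : seq 'I_n) : nat :=
  if s is i :: s' then (count (fun j : 'I_n => (j < i)%N) s' + seq_inv s')%N else 0%N.

Definition leI : rel 'I_n := relpre (@nat_of_ord n) leq.

Lemma lprod_merge i s : sorted leI s -> i \notin s ->
  xi i * lprod xi s =
    (- q^-1) ^+ count (fun j : 'I_n => (j < i)%N) s *: lprod xi (merge leI [:: i] s).
Proof.
elim: s => [|j s IH] ss; first by rewrite /= scale1r lprod_cons.
rewrite inE negb_or => /andP[ij iNs].
have -> : merge leI [:: i] (j :: s) = if leI i j then [:: i, j & s] else j :: merge leI [::
  i] s by [].
rewrite [count _ _]/=; case: ifPn => [le|].
  rewrite (@eq_in_count _ _ pred0) => [|l ls].
    by rewrite count_pred0 ltnNge (le : (i <= j)%N) scale1r !lprod_cons.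
  rewrite /=; apply/negbTE; rewrite -leqNgt; apply: leq_trans le _.
  have tr : transitive leI by move=> a b c; exact: leq_trans.
  by have /allP := order_path_min tr ss; apply.
rewrite /leI /= -ltnNge => ji;
  rewrite ji !lprod_cons mulrA skx.2 // -!scalerAl -mulrA IH ?(path_sorted ss) //.
by rewrite -scalerAr scalerA exprS.
Qed.

(** Insertion sort: by [lprod_merge], a letter inserted into the sorted tail pays [- q^-1] for each
    smaller letter it passes. This gives the exact factor that [lprod_perm] leaves open. *)
Lemma lprod_sort s t : uniq s -> sorted leI t -> perm_eq s t ->
  lprod xi s = (- q^-1) ^+ seq_inv s *: lprod xi t.
Proof.
have tot : total leI by move=> a b; exact: leq_total.
have tr : transitive leI by move=> a b c; exact: leq_trans.
have anti : antisymmetric leI by move=> a b /anti_leq/val_inj.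
elim: s t => [|i s IH] t; first by move=> _ _; rewrite perm_sym => /perm_nilP ->;
  rewrite scale1r.
move=> /= /andP[iNs us] st pst.
have ss : sorted leI (sort leI s) by exact: sort_sorted.
have em : merge leI [:: i] (sort leI s) = t.
  apply: (sorted_eq tr anti) => //; first exact: merge_sorted.
  apply: perm_trans pst; rewrite perm_sym.
  apply: perm_trans (_ : perm_eq (i :: sort leI s) _).
    by rewrite perm_cons perm_sym; apply/permPl; exact: perm_sort.
  by rewrite perm_sym; apply/permPl; exact: (perm_merge leI [:: i]).
have ps : perm_eq s (sort leI s) by rewrite perm_sym; apply/permPl; exact: perm_sort.
rewrite lprod_cons (IH _ us ss ps) -scalerAr lprod_merge //; last by rewrite mem_sort.
by rewrite em scalerA -exprD addnC (seq.permP ps).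
Qed.

Lemma sorted_enum (A : {set 'I_n}) : sorted leI (enum A).
Proof.
have tr : transitive leI by move=> a b c; exact: leq_trans.
rewrite /enum_mem -enumT; apply: sorted_filter => //.
rewrite -sorted_map val_enum_ord; exact: iota_sorted.
Qed.

End Inversions.

Lemma seq_inv_card (l n : nat) (f : 'I_l -> 'I_n) :
  seq_inv [seq f r | r <- enum 'I_l] =
    #|[set p : 'I_l * 'I_l | (p.1 < p.2)%N && (f p.2 < f p.1)%N]|.
Proof.
pose P (a b : 'I_l) := (a < b)%N && (f b < f a)%N.
have gen (t : seq 'I_l) : sorted ltn (map val t) ->
    seq_inv (map f t) = (\sum_(a <- t) \sum_(b <- t) P a b)%N.
  elim: t => [|a t IH] st; first by rewrite big_nil.
  rewrite /= (IH (path_sorted st)) big_cons; congr (_ + _)%N.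
    rewrite big_cons /P ltnn add0n -sum1_count big_map big_mkcond /= [RHS]big_seq [LHS]big_seq.
    apply: eq_bigr => b bt; have /allP /(_ (val b)) := order_path_min ltn_trans st.
    by rewrite map_f // => -> //; case: (_ < _)%N.
  rewrite [LHS]big_seq [RHS]big_seq; apply: eq_bigr => c ct.
  have /allP /(_ (val c)) := order_path_min ltn_trans st.
  by rewrite map_f // => /(_ isT) /= lt; rewrite big_cons /P ltnNge (ltnW lt).
rewrite gen; last by rewrite val_enum_ord iota_ltn_sorted.
rewrite big_enum; under eq_bigr do rewrite big_enum.
rewrite pair_bigA cardsE -sum1_card [RHS]big_mkcond; apply: eq_bigr => p _ /=.
by rewrite /P unfold_in; case: (_ && _).
Qed.

Lemma prod_enum_ord (R : pzRingType) (l : nat) (F : 'I_l -> R) :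
  \prod_(r <- enum 'I_l) F r = \prod_(r < l) F r.
Proof. by rewrite enumT [index_enum _ in RHS]unlock. Qed.

Lemma ltn_enum_val (n : nat) (J : {set 'I_n}) (a b : 'I_#|J|) :
  (enum_val a < enum_val b)%N = (a < b)%N.
Proof.
have lt (c d : 'I_#|J|) : (c < d)%N -> (enum_val c < enum_val d)%N.
  have x0 := enum_val c; move=> cd; rewrite !(enum_val_nth x0) ltn_neqAle.
  rewrite (inj_eq val_inj) nth_uniq ?enum_uniq -?cardE // neq_ltn cd /=.
  have tr : transitive (@leI n) by move=> i j l; exact: leq_trans.
  apply: (sorted_ltn_nth tr _ (sorted_enum J)) => //; by rewrite inE -cardE.
case: (ltngtP a b) => [/lt->//|/lt ba|/val_inj ->]; last by rewrite ltnn.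
by apply/negbTE; rewrite -leqNgt ltnW.
Qed.

Section Minors.
Variables (K : fieldType) (q : K).
Hypothesis q0 : q != 0.

(** The expression of [qminor] for an arbitrary family [x], since minors of transposed and
    row-transformed matrices are needed too. *)
Definition gminor (A : algType K) (k m : nat) (x : 'I_k -> 'I_m -> A)
    (I : {set 'I_k}) (J : {set 'I_m}) (e : #|I| = #|J|) : A :=
  \sum_(s : 'S_#|I|) (- q) ^- perm_length s *:
    \prod_(r < #|I|) x (enum_val r) (enum_val (cast_ord e (s r))).

(** A total version with value 0 for sets of different sizes, which frees statements from the proof
    of equal size. *)
Definition minor (A : algType K) (k m : nat) (x : 'I_k -> 'I_m -> A)
    (I : {set 'I_k}) (J : {set 'I_m}) : A :=
  if @eqP _ #|I| #|J| is ReflectT e then gminor x e else 0.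

Lemma minorE (A : algType K) (k m : nat) (x : 'I_k -> 'I_m -> A)
    (I : {set 'I_k}) (J : {set 'I_m}) (e : #|I| = #|J|) :
  minor x I J = gminor x e.
Proof.
by rewrite /minor; case: eqP => // e'; rewrite (eq_irrelevance e e').
Qed.

Lemma lprod_enum (E : algType K) (n : nat) (F : 'I_n -> E) (I : {set 'I_n}) :
  lprod F (enum I) = \prod_(r < #|I|) F (enum_val r).
Proof.
case: (pickP (mem I)) => [i0 i0I|I0]; last first.
  have -> : I = set0 by apply/setP => i; rewrite inE; exact: I0.
  rewrite enum_set0 lprod_nil big1 // => -[r lt] _; suff: (r < 0)%N by [].
  by rewrite -[0%N](@cards0 'I_n).
rewrite /lprod (big_nth i0) big_mkord -cardE; apply: eq_bigr => r _.
by rewrite (enum_val_nth i0).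
Qed.

Variables (A E : algType K) (iota : {lrmorphism A -> E}) (k m : nat).
Variables (x : 'I_k -> 'I_m -> A) (xi : 'I_m -> E).
Hypotheses (skx : qskew q xi) (cx : central_letters iota xi).

Lemma prod_letters (l : nat) (f : 'I_l -> 'I_m) (a : 'I_l -> A) :
  \prod_(r < l) (xi (f r) * iota (a r)) = \prod_(r < l) xi (f r) * iota (\prod_(r < l) a r).
Proof.
elim: l f a => [|l IH] f a; first by rewrite !big_ord0 rmorph1 mulr1.
rewrite !big_ord_recl IH rmorphM -!mulrA; congr (_ * _); rewrite !mulrA; congr (_ * _).
elim/big_rec: _ => [|r z _ e]; first by rewrite mul1r mulr1.
by rewrite !mulrA -cx -!mulrA e.
Qed.

(** The weight of a permutation in a minor is exactly the cost of sorting the corresponding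
    letters. *)
Lemma lprod_perm_length (l : nat) (J : {set 'I_m}) (e : l = #|J|) (s : 'S_l) :
  \prod_(r < l) xi (enum_val (cast_ord e (s r))) =
    (- q) ^- perm_length s *: lprod xi (enum J).
Proof.
pose f r := enum_val (cast_ord e (s r)).
have fi : injective f by move=> a b /enum_val_inj /cast_ord_inj /perm_inj.
have -> : \prod_(r < l) xi (f r) = lprod xi [seq f r | r <- enum 'I_l].
  by rewrite /lprod [RHS]big_map prod_enum_ord.
rewrite (lprod_sort skx (t := enum J)) ?sorted_enum //.
- rewrite seq_inv_card -exprVn invrN; congr (_ ^+ _ *: _).
  by apply: eq_card => p; rewrite !inE /f !ltn_enum_val.
- by rewrite map_inj_uniq // enum_uniq.
apply: uniq_perm; [by rewrite map_inj_uniq // enum_uniq|exact: enum_uniq|move=> j].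
apply/mapP/idP => [[r _ ->]|]; first by rewrite mem_enum /f enum_valP.
rewrite mem_enum => jJ; exists (s^-1%g (cast_ord (esym e) (enum_rank_in jJ j))).
  by rewrite mem_enum.
by rewrite /f permKV cast_ordKV enum_rankK_in.
Qed.

(** Expanding the product gives a sum over functions from rows to columns. A function that is not
    injective repeats a letter and contributes 0; those with image [J] correspond to permutations
    and add up to the minor. *)
Lemma lprod_rowsum (I : {set 'I_k}) :
  lprod (rowsum iota x xi) (enum I) =
    \sum_(J : {set 'I_m} | #|J| == #|I|) lprod xi (enum J) * iota (minor x I J).
Proof.
rewrite lprod_enum /rowsum bigA_distr_bigA /=.
under eq_bigr do rewrite prod_letters.
rewrite (partition_big (fun f : {ffun _} => [set f r | r in [set: 'I_#|I|]]) predT) //=.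
rewrite (bigID (fun J : {set 'I_m} => #|J| == #|I|)) /= [X in _ + X]big1 ?addr0; last first.
  move=> J nJ; rewrite big1 // => f /eqP fJ.
  rewrite (_ : \prod_(r < _) _ = lprod xi [seq f r | r <- enum 'I_#|I|]); last first.
    by rewrite /lprod [RHS]big_map prod_enum_ord.
  rewrite (lprod_dup q0 skx) ?mul0r //; apply: contra nJ => uf.
  rewrite -fJ card_in_imset ?cardsT ?card_ord // => a b _ _.
  by have /injectiveP fi : injectiveb f := uf; exact: fi.
apply: eq_bigr => J /eqP/esym e; rewrite (minorE x e) linear_sum mulr_sumr /=.
pose h (s : 'S_#|I|) : {ffun 'I_#|I| -> 'I_m} := [ffun r => enum_val (cast_ord e (s r))].
pose G (f : {ffun 'I_#|I| -> 'I_m}) :=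
  \prod_r xi (f r) * iota (\prod_r x (enum_val r) (f r)).
have hi : injective h.
  move=> s t /ffunP est; apply/permP => r; have := est r; rewrite !ffunE.
  by move=> /enum_val_inj /cast_ord_inj.
transitivity (\sum_s G (h s)); last first.
  apply: eq_bigr => s _; rewrite /G linearZ -scalerAr scalerAl -lprod_perm_length.
  by congr (_ * iota _); apply: eq_bigr => r _; rewrite ffunE.
transitivity (\sum_(f in h @: [set: 'S_#|I|]) G f); last first.
  rewrite big_imset /=; last by move=> s t _ _; exact: hi.
  by apply: eq_bigl => s; rewrite inE.
apply: eq_bigl => f; apply/eqP/imsetP => [fJ|[s _ ->]]; last first.
  apply/setP => j; apply/imsetP/idP => [[r _ ->]|jJ]; first by rewrite ffunE enum_valP.
  exists (s^-1%g (cast_ord (esym e) (enum_rank_in jJ j))); first by rewrite inE.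
  by rewrite ffunE permKV cast_ordKV enum_rankK_in.
have fi : injective f.
  move=> a b; apply: (imset_injP (D := setT) _) => //.
  by rewrite fJ -e cardsT card_ord.
have fm r : f r \in J by rewrite -fJ imset_f.
pose g r := cast_ord (esym e) (enum_rank_in (fm r) (f r)).
have gi : injective g.
  move=> a b /cast_ord_inj eab; apply: fi.
  by rewrite -(enum_rankK_in (fm a) (fm a)) eab enum_rankK_in.
exists (perm gi); first by rewrite inE.
apply/ffunP => r.
by rewrite ffunE permE cast_ordKV enum_rankK_in.
Qed.
End Minors.

(** * A model for the letters *)

Section MatrixAlgebra.
Variables (K : fieldType) (E : algType K) (n : nat).

(** Stands for the tensor product of [E] with matrices over [K]. It is a type of its own because the
    scalars are [K] rather than [E]. *)
Definition mxalg : Type := 'M[E]_n.+1.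
HB.instance Definition _ := GRing.NzRing.on mxalg.

Definition mxalg_scale (c : K) (M : mxalg) : mxalg := \matrix_(i, j) (c *: M i j).

Fact mxalg_scaleA c d M : mxalg_scale c (mxalg_scale d M) = mxalg_scale (c * d) M.
Proof. by apply/matrixP => i j; rewrite !mxE scalerA. Qed.
Fact mxalg_scale1 : left_id 1 mxalg_scale.
Proof. by move=> M; apply/matrixP => i j; rewrite !mxE scale1r. Qed.
Fact mxalg_scaleDr : right_distributive mxalg_scale +%R.
Proof. by move=> c M N; apply/matrixP => i j; rewrite !mxE scalerDr. Qed.
Fact mxalg_scaleDl M : {morph mxalg_scale^~ M : c d / c + d}.
Proof. by move=> c d; apply/matrixP => i j; rewrite !mxE scalerDl. Qed.
HB.instance Definition _ := GRing.Zmodule_isLmodule.Build K mxalg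
  mxalg_scaleA mxalg_scale1 mxalg_scaleDr mxalg_scaleDl.

Fact mxalg_scaleAl (c : K) (M N : mxalg) : c *: (M * N) = (c *: M) * N.
Proof.
apply/matrixP => i j; rewrite !mxE scaler_sumr; apply: eq_bigr => l _.
by rewrite !mxE scalerAl.
Qed.
HB.instance Definition _ := GRing.Lmodule_isLalgebra.Build K mxalg mxalg_scaleAl.
Fact mxalg_scaleAr (c : K) (M N : mxalg) : c *: (M * N) = M * (c *: N).
Proof.
apply/matrixP => i j; rewrite !mxE scaler_sumr; apply: eq_bigr => l _.
by rewrite !mxE scalerAr.
Qed.
HB.instance Definition _ := GRing.Lalgebra_isAlgebra.Build K mxalg mxalg_scaleAr.

(** The pure tensor of [u] and [t]. *)
Definition tens (u : E) (t : 'M[K]_n.+1) : mxalg := \matrix_(i, j) (t i j *: u).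

Lemma tensM u v s t : tens u s * tens v t = tens (u * v) (s * t).
Proof.
apply/matrixP => i j; rewrite !mxE scaler_suml; apply: eq_bigr => l _.
by rewrite !mxE -scalerAl -scalerAr scalerA.
Qed.
Lemma tensZr c u t : tens u (c *: t) = c *: tens u t.
Proof. by apply/matrixP => i j; rewrite !mxE scalerA. Qed.
Lemma tensZl c u t : tens (c *: u) t = c *: tens u t.
Proof. by apply/matrixP => i j; rewrite !mxE !scalerA mulrC. Qed.
Lemma tensDr u s t : tens u (s + t) = tens u s + tens u t.
Proof. by apply/matrixP => i j; rewrite !mxE scalerDl. Qed.
Lemma tensDl u v t : tens (u + v) t = tens u t + tens v t.
Proof. by apply/matrixP => i j; rewrite !mxE scalerDr. Qed.
Lemma tens0r u : tens u 0 = 0.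
Proof. by apply/matrixP => i j; rewrite !mxE scale0r. Qed.

Definition mxscal (u : E) : mxalg := tens u 1.

Fact mxscal_linear : linear mxscal.
Proof. by move=> c u v; rewrite /mxscal tensDl tensZl. Qed.
Fact mxscal_monoid : monoid_morphism mxscal.
Proof.
split=> [|u v]; last by rewrite /mxscal tensM mulr1.
by apply/matrixP => i j; rewrite !mxE scaler_nat.
Qed.
HB.instance Definition _ := GRing.isLinear.Build K E mxalg _ mxscal mxscal_linear.
HB.instance Definition _ := GRing.isMonoidMorphism.Build E mxalg mxscal mxscal_monoid.
End MatrixAlgebra.

Section Model.
Variables (K : fieldType) (q : K).
Hypothesis q0 : q != 0.

(* The letters xi and eta of one index act on a space with basis
   v, xi v, eta v, xi eta v; the diagonal a, b and the lowering F are the data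
   needed to adjoin this index to the previous ones. *)
Definition site_xi_fun (i j : nat) : K :=
  match i, j with 1%N, 0%N => 1 | 3%N, 2%N => 1 | _, _ => 0 end.
Definition site_eta_fun (i j : nat) : K :=
  match i, j with 2%N, 0%N => 1 | 3%N, 1%N => q | _, _ => 0 end.
Definition site_a_fun (i j : nat) : K :=
  match i, j with 0%N, 0%N => 1 | 1%N, 1%N => - q^-1 | 2%N, 2%N => 1 | 3%N, 3%N => - q^-1
  | _, _ => 0 end.
Definition site_b_fun (i j : nat) : K :=
  match i, j with 0%N, 0%N => 1 | 1%N, 1%N => 1 | 2%N, 2%N => - q^-1 | 3%N, 3%N => - q^-1
  | _, _ => 0 end.
Definition site_F_fun (i j : nat) : K :=
  match i, j with 2%N, 1%N => q - q^-1 | _, _ => 0 end.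

Definition site_xi : 'M[K]_4 := \matrix_(i, j) site_xi_fun i j.
Definition site_eta : 'M[K]_4 := \matrix_(i, j) site_eta_fun i j.
Definition site_a : 'M[K]_4 := \matrix_(i, j) site_a_fun i j.
Definition site_b : 'M[K]_4 := \matrix_(i, j) site_b_fun i j.
Definition site_F : 'M[K]_4 := \matrix_(i, j) site_F_fun i j.

Definition site_rel : Prop :=
  (site_xi * site_xi = 0 /\ site_eta * site_eta = 0) /\
  (site_eta * site_xi = q *: (site_xi * site_eta) /\
   site_a * site_xi = - q^-1 *: (site_xi * site_a)) /\
  (site_a * site_eta = site_eta * site_a /\
   site_b * site_xi = site_xi * site_b) /\
  (site_b * site_eta = - q^-1 *: (site_eta * site_b) /\
   site_F * site_xi = site_xi * site_F + (q - q^-1) *: (site_a * site_eta)) /\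
  (site_F * site_eta = - q^-1 *: (site_eta * site_F) /\
   site_a * site_b = site_b * site_a) /\
  (site_a * site_F = - q *: (site_F * site_a) /\
   site_F * site_b = - q *: (site_b * site_F)).

Lemma mx4M (s t : 'M[K]_4) (i j : 'I_4) :
  (s * t) i j = s i (@Ordinal 4 0 isT) * t (@Ordinal 4 0 isT) j
    + s i (@Ordinal 4 1 isT) * t (@Ordinal 4 1 isT) j
    + s i (@Ordinal 4 2 isT) * t (@Ordinal 4 2 isT) j
    + s i (@Ordinal 4 3 isT) * t (@Ordinal 4 3 isT) j.
Proof.
rewrite mxE !big_ord_recr big_ord0 /= add0r.
by congr (_ * _ + _ * _ + _ * _ + _ * _); congr (fun_of_matrix _ _ _); apply: val_inj.
Qed.

Lemma site_relP : site_rel.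
Proof.
have mxs (f g : nat -> nat -> K) : (\matrix_(i, j) f i j : 'M[K]_4) * (\matrix_(i, j) g i j) =
    \matrix_(i, j) (f i 0%N * g 0%N j + f i 1%N * g 1%N j + f i 2%N * g 2%N j + f i 3%N * g
      3%N j).
  by apply/matrixP => i j; rewrite mx4M !mxE.
rewrite /site_rel /site_xi /site_eta /site_a /site_b /site_F !mxs.
repeat split; apply/matrixP => i j; rewrite !mxE.
all: case: i j => [[|[|[|[|//]]]] hi] [[|[|[|[|//]]]] hj]; rewrite /=.
all: by field.
Qed.
End Model.

Section Stage.
Variables (K : fieldType) (q : K).
Hypothesis q0 : q != 0.

(* As in a Jordan-Wigner construction, the letters of index n are added to an
   algebra E by passing to 4 x 4 matrices over E, with
   xi_n = a (x) xi and eta_n = b (x) eta + F (x) xi; F makes up for the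
   non-monomial relation [lp_gt].  The vacuum functional [phi] sees that the
   product of all letters is nonzero. *)
Record stage (A E : algType K) (iota : {lrmorphism A -> E}) (n : nat)
    (xi eta : nat -> E) (a b F : E) (phi : E -> A) : Prop := Stage {
  st_lp : letter_pair q (fun i : 'I_n => xi i) (fun i : 'I_n => eta i);
  st_ax : forall i, (i < n)%N -> a * xi i = - q^-1 *: (xi i * a);
  st_ae : forall i, (i < n)%N -> a * eta i = eta i * a;
  st_bx : forall i, (i < n)%N -> b * xi i = xi i * b;
  st_be : forall i, (i < n)%N -> b * eta i = - q^-1 *: (eta i * b);
  st_Fx : forall i, (i < n)%N -> F * xi i = xi i * F + (q - q^-1) *: (a * eta i);
  st_Fe : forall i, (i < n)%N -> F * eta i = - q^-1 *: (eta i * F);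
  st_ab : a * b = b * a;
  st_aF : a * F = - q *: (F * a);
  st_Fb : F * b = - q *: (b * F);
  st_cent : forall z, [/\ forall i, (i < n)%N -> xi i * iota z = iota z * xi i,
    forall i, (i < n)%N -> eta i * iota z = iota z * eta i, a * iota z = iota z * a,
    b * iota z = iota z * b & F * iota z = iota z * F];
  st_phi0 : phi 0 = 0;
  st_phia : forall z, phi (z * a) = phi z;
  st_phib : forall z, phi (z * b) = phi z;
  st_top : forall z,
    phi (\prod_(i < n) xi i * \prod_(i < n) eta i * iota z) = z }.

(** The new functional reads the entry (3, 0), the component along xi eta v of the image of v, where
    the product of the two new letters is visible. *)
Lemma stageS (A E : algType K) (iota : {lrmorphism A -> E}) n xi eta a b F phi :
  stage iota n xi eta a b F phi ->
  stage (@mxscal K E 3 \o iota : {lrmorphism A -> mxalg E 3}) n.+1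
    (fun i => if (i < n)%N then mxscal 3 (xi i) else tens a (site_xi K))
    (fun i => if (i < n)%N then mxscal 3 (eta i) else tens b (site_eta q) + tens F (site_xi K))
    (tens a (site_a q)) (tens b (site_b q)) (tens F (site_a q) + tens b (site_F q))
    (fun M => phi (M (@Ordinal 4 3 isT) (@Ordinal 4 0 isT))).
Proof.
case: (site_relP q0) => [[XX YY] [[YX aX] [[aY bX] [[bY FX] [[FY ab] [aF Fb]]]]]].
case=> lp ax ae bx be Fx Fe sab saF sFb cent phi0 phia phib top.
have [skx ske dg lt gt] := lp.
have qV : (- q^-1) * (- q) = 1 by rewrite mulrNN mulVf.
have Vq : (- q) * (- q^-1) = 1 by rewrite mulrNN divff.
have below (i j : 'I_n.+1) : (i < j)%N -> (i < n)%N.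
  by move=> ij; exact: leq_trans ij (ltn_ord j).
split.
- split.
  + split=> [i|i j ij].
      case: ifP => hi; first by rewrite -rmorphM /= (skx.1 (Ordinal hi)) rmorph0.
      by rewrite tensM XX tens0r.
    rewrite (below _ _ ij); case: (ltnP j n) => hj.
      rewrite -!rmorphM /=.
      by rewrite (skx.2 (Ordinal (below _ _ ij)) (Ordinal hj) ij) linearZ.
    by rewrite /mxscal !tensM mul1r mulr1 ax ?(below _ _ ij) // tensZl.
  + split=> [i|i j ij].
      case: ifP => hi; first by rewrite -rmorphM /= (ske.1 (Ordinal hi)) rmorph0.
      rewrite mulrDl !mulrDr !tensM YY XX !tens0r add0r addr0.
      by rewrite YX sFb tensZr tensZl scaleNr addrN.
    rewrite (below _ _ ij); case: (ltnP j n) => hj.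
      rewrite -!rmorphM /=.
      by rewrite (ske.2 (Ordinal (below _ _ ij)) (Ordinal hj) ij) linearZ.
    rewrite mulrDl mulrDr /mxscal !tensM !mul1r !mulr1 be ?Fe ?(below _ _ ij) //.
    by rewrite !tensZl scalerDr.
  + move=> i; case: ifP => hi; first by rewrite -!rmorphM /= (dg (Ordinal hi)) linearZ.
    by rewrite mulrDl mulrDr !tensM XX !tens0r !addr0 YX sab tensZr.
  + move=> i j ij; rewrite (below _ _ ij); case: (ltnP j n) => hj.
      by rewrite -!rmorphM /= (lt (Ordinal (below _ _ ij)) (Ordinal hj) ij).
    by rewrite /mxscal !tensM mul1r mulr1 ae ?(below _ _ ij).
  + move=> i j ij; rewrite (below _ _ ij); case: (ltnP j n) => hj.
      by rewrite -!rmorphM /= (gt (Ordinal (below _ _ ij)) (Ordinal hj) ij) linearD linearZ.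
    rewrite mulrDl mulrDr /mxscal !tensM !mul1r !mulr1 bx ?Fx ?(below _ _ ij) //.
    by rewrite tensDl tensZl addrA.
- move=> i; rewrite ltnS => le; case: ifP => hi; rewrite ?/mxscal !tensM.
    by rewrite mul1r mulr1 ax // tensZl.
  by rewrite aX tensZr.
- move=> i; rewrite ltnS => le; case: ifP => hi; rewrite ?/mxscal ?mulrDr ?mulrDl !tensM.
    by rewrite mul1r mulr1 ae.
  by rewrite sab aY saF aX tensZr tensZl scalerA ?qV ?Vq scale1r.
- move=> i; rewrite ltnS => le; case: ifP => hi; rewrite ?/mxscal ?mulrDr ?mulrDl !tensM.
    by rewrite mul1r mulr1 bx.
  by rewrite bX sab.
- move=> i; rewrite ltnS => le; case: ifP => hi; rewrite ?/mxscal ?mulrDr ?mulrDl !tensM.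
    by rewrite mul1r mulr1 be // tensZl.
  by rewrite bY bX sFb tensZr tensZl scalerDr scalerA ?qV ?Vq scale1r.
- move=> i; rewrite ltnS => le; case: ifP => hi; rewrite ?/mxscal ?mulrDr ?mulrDl !tensM.
    rewrite !mul1r !mulr1 Fx // bx // ae //.
    by rewrite tensDl tensZl addrAC.
  rewrite FX aX saF sab tensDr !tensZr !tensZl scalerA ?qV ?Vq scale1r scalerDr.
  set p := tens (F * a) _.
  have -> : - q^-1 *: p = - q *: p + (q - q^-1) *: p.
    by rewrite -scalerDl; congr (_ *: _); ring.
  by rewrite -!addrA; congr (_ + _); rewrite addrCA; congr (_ + _); exact: addrC.
- move=> i; rewrite ltnS => le; case: ifP => hi; rewrite ?/mxscal ?mulrDr ?mulrDl !tensM.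
    by rewrite !mul1r !mulr1 Fe // be // !tensZl scalerDr.
  rewrite sFb FY FX aX aY !tensDr !tensZr !tensZl !scalerDr scalerA ?qV ?Vq scale1r.
  set p := tens (b * F) (site_eta q * _).
  have -> : - q^-1 *: p = - q *: p + (q - q^-1) *: p.
    by rewrite -scalerDl; congr (_ *: _); ring.
  rewrite -!addrA; congr (_ + _); rewrite [LHS]addrCA [RHS]addrCA.
  by rewrite [X in _ = _ + X]addrC -addrA.
- by rewrite !tensM sab ab.
- by rewrite mulrDl mulrDr !tensM saF sab aF tensZr tensZl scalerDr.
- by rewrite mulrDl mulrDr !tensM sFb Fb ab tensZr tensZl scalerDr.
- move=> z; have [cx ce ca cb cF] := cent z; split=> [i le|i le|||].
  + case: ifP => hi; first by rewrite /= -!rmorphM /= cx.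
    by rewrite /= /mxscal !tensM mul1r mulr1 ca.
  + case: ifP => hi; first by rewrite /= -!rmorphM /= ce.
    by rewrite /= /mxscal mulrDr mulrDl !tensM !mul1r !mulr1 cb cF.
  + by rewrite /= /mxscal !tensM mul1r mulr1 ca.
  + by rewrite /= /mxscal !tensM mul1r mulr1 cb.
  + by rewrite /= /mxscal mulrDr mulrDl !tensM !mul1r !mulr1 cb cF.
- by rewrite mxE phi0.
- move=> z; rewrite mxE (bigD1 (@Ordinal 4 0 isT)) //= big1 ?addr0.
    by rewrite !mxE /= scale1r phia.
  by move=> [[|[|[|[|//]]]] hi] //= _; rewrite !mxE /= scale0r mulr0.
- move=> z; rewrite mxE (bigD1 (@Ordinal 4 0 isT)) //= big1 ?addr0.
    by rewrite !mxE /= scale1r phib.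
  by move=> [[|[|[|[|//]]]] hi] //= _; rewrite !mxE /= scale0r mulr0.
- move=> z; rewrite !big_ord_recr /= !ltnn.
  set P := \prod_(i < n) _; set Q := \prod_(i < n) _.
  have -> : P = mxscal 3 (\prod_(i < n) xi i).
    by rewrite rmorph_prod; apply: eq_bigr => i _; rewrite ltn_ord.
  have -> : Q = mxscal 3 (\prod_(i < n) eta i).
    by rewrite rmorph_prod; apply: eq_bigr => i _; rewrite ltn_ord.
  have aQ : a * \prod_(i < n) eta i = (\prod_(i < n) eta i) * a.
    by apply: commr_prod => i _; exact: ae.
  have [_ _ ca cb _] := cent z.
  (* The part with [F] dies because [site_xi] squares to zero, and [site_xi * site_eta] has entry 1
     at (3, 0). The old product remains, times [a] and [b], which [phi] ignores. *)
  rewrite /mxscal !mulrDr mulrDl !tensM !mulr1 !mul1r XX !mulrA.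
  rewrite tens0r addr0 mxE mx4M !mxE /= !(mul0r, mulr0, addr0, add0r, mulr1) scale1r.
  rewrite -(mulrA _ a) aQ -!mulrA cb (mulrA a) ca -!mulrA !mulrA -!(mulrA _ a b).
  by rewrite mulrA phib phia top.
Qed.

Lemma letter_model (A : algType K) (n : nat) :
  exists (E : algType K) (iota : {lrmorphism A -> E}) xi eta a b F phi,
    @stage A E iota n xi eta a b F phi.
Proof.
elim: n => [|n [E [iota [xi [eta [a [b [F [phi st]]]]]]]]]; last first.
  by do 8!eexists; exact: stageS st.
exists A, idfun, (fun=> 0), (fun=> 0), 1, 1, 0, id.
split=> //; rewrite ?mulr1 ?mul1r ?mulr0 ?mul0r ?scaler0 //.
- by split=> [||[]|[]|[]] //; split=> [[]|[]].
- by move=> z; split=> //; rewrite ?mulr1 ?mul1r ?mulr0 ?mul0r.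
- by move=> z; rewrite mulr1.
- by move=> z; rewrite mulr1.
- by move=> z; rewrite !big_ord0 !mul1r.
Qed.
End Stage.

Section LettersOn.
Variables (K : fieldType) (q : K).
Hypothesis q0 : q != 0.

(** In each relation all terms involve the same indices, so the letters outside [U] may be set to
    0. *)
Lemma letter_pair_restrict (E : algType K) (m : nat) (U : {set 'I_m}) (xi eta : 'I_m -> E) :
  letter_pair q xi eta ->
  letter_pair q (fun i => if i \in U then xi i else 0) (fun i => if i \in U then eta i else 0).
Proof.
case=> -[sx wx] [se we] dg lt gt.
split; [split=> [i|i j ij]|split=> [i|i j ij]|move=> i|move=> i j ij|move=> i j ij];
  case: ifP => _; try (case: ifP => _); rewrite ?(mulr0, mul0r, scaler0, addr0) //; auto.
Qed.

(** For the cancellation property, the letters outside [U] are multiplied on, [xi] from the left and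
    [eta] from the right. This completes the product to that of all letters, from which [phi]
    recovers [z]. *)
Lemma letters_on (A : algType K) (m : nat) (U : {set 'I_m}) :
  exists (E : algType K) (iota : {lrmorphism A -> E}) xi eta,
  [/\ letter_pair q xi eta, central_letters iota xi, central_letters iota eta,
      (forall i : 'I_m, i \notin U -> xi i = 0 /\ eta i = 0) &
      forall z w, lprod xi (enum U) * lprod eta (enum U) * iota z =
        lprod xi (enum U) * lprod eta (enum U) * iota w -> z = w].
Proof.
have [E [iota [xi [eta [a [b [F [phi st]]]]]]]] := letter_model q0 A m.
exists E, iota, (fun i => if i \in U then xi i else 0), (fun i => if i \in U then eta i else 0).
have lp := st_lp st.
have cx (i : 'I_m) z : xi i * iota z = iota z * xi i by case: (st_cent st z) => c _ _ _ _;
  exact: c.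
have ce (i : 'I_m) z : eta i * iota z = iota z * eta i by case: (st_cent st z) => _ c _ _ _;
  exact: c.
split; first exact: letter_pair_restrict lp.
- by move=> i z /=; case: ifP => _; rewrite ?cx ?mulr0 ?mul0r.
- by move=> i z /=; case: ifP => _; rewrite ?ce ?mulr0 ?mul0r.
- by move=> i /negPf ->.
have eU (f : nat -> E) :
    lprod (fun i : 'I_m => if i \in U then f i else 0) (enum U) = lprod (fun i : 'I_m => f i)
      (enum U).
  by rewrite /lprod big_seq [RHS]big_seq; apply: eq_bigr => i; rewrite mem_enum => ->.
rewrite !eU => z w e.
set X := lprod _ _ in e; set Y := lprod _ _ in e.
pose X' := lprod (fun i : 'I_m => xi i) (enum (~: U)).
pose Y' := lprod (fun i : 'I_m => eta i) (enum (~: U)).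
have pU : perm_eq (enum (~: U) ++ enum U) (enum 'I_m).
  apply: uniq_perm; rewrite ?enum_uniq // ?cat_uniq ?enum_uniq /= ?andbT.
    by apply/hasPn => i; rewrite /= !mem_enum inE negbK.
  by move=> i; rewrite mem_cat !mem_enum inE /= orNb.
have [c c0 ec] := lprod_perm q0 (lp_xi lp) pU.
have pU' : perm_eq (enum U ++ enum (~: U)) (enum 'I_m) by rewrite perm_catC.
have [d d0 ed] := lprod_perm q0 (lp_eta lp) pU'.
have top u : X' * (X * Y * iota u) * Y' = (c * d) *:
    (\prod_(i < m) xi i * \prod_(i < m) eta i * iota u).
  have cY : iota u * Y' = Y' * iota u.
    by apply: commr_prod => i _; exact/esym/ce.
  rewrite -!mulrA cY !mulrA -lprod_cat -(mulrA _ Y) -lprod_cat ec ed.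
  by rewrite -!(scalerAl, scalerAr) scalerA /lprod !prod_enum_ord.
have := congr1 (fun M => X' * M * Y') e; rewrite /= !top => /(scalerI _) h.
by rewrite -(st_top st z) -(st_top st w) h // mulf_neq0.
Qed.
End LettersOn.

(** * Exchange of minors *)

Section Exchange.
Variables (K : fieldType) (q : K).
Hypothesis q0 : q != 0.

Lemma central_lprod (A E : algType K) (iota : {lrmorphism A -> E}) (m : nat)
    (xi : 'I_m -> E) (s : seq 'I_m) (z : A) :
  central_letters iota xi -> lprod xi s * iota z = iota z * lprod xi s.
Proof. by move=> cx; apply/esym; apply: commr_prod => i _; exact/esym/cx. Qed.

Lemma count_mem_enum (n : nat) (S T : {set 'I_n}) :
  count (mem (enum T)) (enum S) = #|S :&: T|.
Proof.
rewrite -size_filter cardE; apply/perm_size/uniq_perm;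
  [exact: filter_uniq (enum_uniq _)|exact: enum_uniq|move=> i].
by rewrite mem_filter /= !mem_enum inE andbC.
Qed.

Lemma mul_central_sums (A E : algType K) (iota : {lrmorphism A -> E}) (I1 I2 : finType)
    (P1 : pred I1) (P2 : pred I2) (a : I1 -> E) (b : I2 -> E) (c : I1 -> A) (d : I2 -> A) (u
      v : E) :
  (forall j z, b j * iota z = iota z * b j) -> (forall z, v * iota z = iota z * v) ->
  u * ((\sum_(i | P1 i) a i * iota (c i)) * (\sum_(j | P2 j) b j * iota (d j))) * v =
  \sum_(i | P1 i) \sum_(j | P2 j) u * a i * b j * v * iota (c i * d j).
Proof.
move=> cb cv; rewrite mulr_suml mulr_sumr mulr_suml; apply: eq_bigr => i _.
rewrite !mulr_sumr mulr_suml; apply: eq_bigr => j _.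
rewrite rmorphM -!mulrA -cv; do 2!congr (_ * _).
by rewrite !mulrA -cb -!mulrA; congr (_ * _); rewrite !mulrA cv -!mulrA cv.
Qed.

Lemma eq_card_disjoint (n : nat) (L Q G : {set 'I_n}) :
  #|L| = #|Q| -> L \subset Q :|: G -> [disjoint L & G] -> L = Q.
Proof.
move=> c s d; apply/eqP; rewrite eqEcard c leqnn andbT; apply/subsetP => i iL.
have := subsetP s i iL; rewrite inE => /orP[//|iG].
by have := disjointFr d iL; rewrite iG.
Qed.

(** The exchange relation for the row products [Y] over [R1] and [X] over [R2] is multiplied by [xi]
    on [Q1 :\: Q2] and by [eta] on [Q2 :\: Q1]. After expansion only the column sets [Q1] and [Q2]
    survive. *)
Lemma minor_exchange (A : algType K) (k m : nat) (x : 'I_k -> 'I_m -> A)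
    (R1 R2 : {set 'I_k}) (Q1 Q2 : {set 'I_m}) :
  qmat_rel q x -> #|R1| = #|Q1| -> #|R2| = #|Q2| ->
  (forall i j, i \in R1 :\: R2 -> j \in R2 :\: R1 -> (i < j)%N) ->
  (forall i j, i \in Q2 :\: Q1 -> j \in Q1 :\: Q2 -> (i < j)%N) ->
  q ^+ #|R1 :&: R2| *: (minor q x R2 Q2 * minor q x R1 Q1) =
  q ^+ #|Q1 :&: Q2| *: (minor q x R1 Q1 * minor q x R2 Q2).
Proof.
move=> hx c1 c2 ltR ltQ; pose U := Q1 :|: Q2.
have [E [iota [xi [eta [lp cx ce z0 inj]]]]] := letters_on q0 A U.
have skx := lp_xi lp; have ske := lp_eta lp.
have lpXY := letter_pair_rowsum q0 hx lp cx ce.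
set X := rowsum iota x xi in lpXY; set Y := rowsum iota x eta in lpXY.
pose g := enum (Q1 :\: Q2); pose h := enum (Q2 :\: Q1).
pose Z (J L : {set 'I_m}) := lprod xi g * lprod xi (enum L) * lprod eta (enum J) * lprod eta h.
have zx (L : {set 'I_m}) : ~~ (L \subset U) -> lprod xi (enum L) = 0 /\ lprod eta (enum L) = 0.
  case/subsetPn => i iL iU; have [e1 e2] := z0 i iU.
  have [c _ ->] := lprod_perm q0 skx (perm_to_rem (etrans (mem_enum _ _) iL)).
  have [d _ ->] := lprod_perm q0 ske (perm_to_rem (etrans (mem_enum _ _) iL)).
  by rewrite !lprod_cons e1 e2 !mul0r !scaler0.
have Z0 (J L : {set 'I_m}) : #|J| = #|Q1| -> #|L| = #|Q2| -> (J != Q1) || (L != Q2) -> Z J L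
  = 0.
  move=> cJ cL; rewrite /Z.
  case: (boolP (L \subset U)) => [sL|/zx[-> _]]; last by rewrite mulr0 !mul0r.
  case: (boolP (J \subset U)) => [sJ|/zx[_ ->]]; last by rewrite mulr0 !mul0r.
  case/orP => [nJ|nL].
    case: (boolP [disjoint J & Q2 :\: Q1]) => [d|/pred0Pn[i /andP[/= iJ ih]]].
      case/eqP: nJ; apply: eq_card_disjoint d => //; apply: subset_trans sJ _.
      by apply/subsetP => j; rewrite !inE; case: (j \in Q1).
    by rewrite -mulrA (@lprod_eq0_meet _ _ q0 _ _ eta _ _ i) ?mem_enum // mulr0.
  case: (boolP [disjoint L & Q1 :\: Q2]) => [d|/pred0Pn[i /andP[/= iL ig]]].
    case/eqP: nL; apply: eq_card_disjoint d => //; apply: subset_trans sL _.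
    by apply/subsetP => j; rewrite !inE; case: (j \in Q2) => //; rewrite orbF.
  by rewrite (@lprod_eq0_meet _ _ q0 _ _ xi _ _ i) ?mem_enum // !mul0r.
have sep (J L : {set 'I_m}) : #|J| = #|Q1| -> #|L| = #|Q2| ->
    lprod xi g * lprod eta (enum J) * lprod xi (enum L) * lprod eta h =
    q ^+ #|Q1 :&: Q2| *: Z J L.
  move=> cJ cL; rewrite /Z.
  case: (boolP (L \subset U)) => [sL|/zx[-> _]]; last by rewrite !mulr0 !mul0r scaler0.
  case: (boolP (J \subset U)) => [sJ|/zx[_ ->]]; last by rewrite !mulr0 !mul0r scaler0.
  exact: lprod_separate.
(* The rows contribute the power of [q] with exponent [#|R1 :&: R2|] here, the columns the one with
   exponent [#|Q1 :&: Q2|] through [sep]. *)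
have exch : lprod xi g * (lprod Y (enum R1) * lprod X (enum R2)) * lprod eta h =
    q ^+ #|R1 :&: R2| *: (lprod xi g * (lprod X (enum R2) * lprod Y (enum R1)) * lprod eta h).
  rewrite -count_mem_enum (lprod_exchange q0 lpXY) ?enum_uniq -?(scalerAl, scalerAr) //.
  move=> i j; rewrite !mem_enum => i1 i2 j2 j1.
  by rewrite ltR ?inE ?i1 ?i2 ?j1 ?j2.
move: exch; rewrite !(lprod_rowsum q0 x) // !mul_central_sums //; try by move=> *;
  exact: central_lprod.
rewrite (bigD1 Q1) ?c1 //= [X in _ + X]big1 => [|J /andP[/eqP cJ nJ]]; last first.
  rewrite big1 // => L /eqP cL; rewrite sep ?cJ ?cL ?c1 ?c2 // Z0 ?cJ ?cL ?nJ //.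
  by rewrite scaler0 mul0r.
rewrite addr0 (bigD1 Q2) ?c2 //= [X in _ + X]big1 => [|L /andP[/eqP cL nL]]; last first.
  by rewrite sep ?cL ?c2 // Z0 ?cL ?nL ?orbT // scaler0 mul0r.
rewrite addr0 sep // (bigD1 Q2) //= [X in _ + X]big1 => [|L /andP[/eqP cL nL]]; last first.
  by rewrite big1 // => J /eqP cJ; rewrite -/(Z J L) Z0 ?cJ ?cL ?nL ?orbT ?mul0r.
rewrite addr0 (bigD1 Q1) //= [X in _ + X]big1 => [|J /andP[/eqP cJ nJ]]; last first.
  by rewrite -/(Z J Q2) Z0 ?cJ ?nJ ?mul0r.
rewrite addr0 -/(Z Q1 Q2) -!scalerAl.
have pg : perm_eq (g ++ enum Q2) (enum U).
  apply: uniq_perm; rewrite ?cat_uniq ?enum_uniq //= ?andbT.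
    by apply/hasPn => i; rewrite /= !mem_enum inE => ->.
  by move=> i; rewrite mem_cat !mem_enum !inE; case: (i \in Q2); rewrite ?orbT ?orbF.
have ph : perm_eq (enum Q1 ++ h) (enum U).
  apply: uniq_perm; rewrite ?cat_uniq ?enum_uniq //= ?andbT.
    by apply/hasPn => i; rewrite /= !mem_enum inE => /andP[].
  by move=> i; rewrite mem_cat !mem_enum !inE; case: (i \in Q1); rewrite ?orbT ?orbF.
have [c c0 ec] := lprod_perm q0 skx pg; have [d d0 ed] := lprod_perm q0 ske ph.
have -> : Z Q1 Q2 = (c * d) *: (lprod xi (enum U) * lprod eta (enum U)).
  by rewrite /Z -lprod_cat -mulrA -lprod_cat ec ed -!(scalerAl, scalerAr) scalerA.
rewrite -!scalerAl !scalerA !(mulrC (q ^+ _)) -!(scalerA (c * d)).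
move/(scalerI (mulf_neq0 c0 d0)) => e; apply/esym/inj.
by rewrite !linearZ -!scalerAr.
Qed.
End Exchange.

(** * Powers of sums of letters *)

Section SkewPowers.
Variables (K : fieldType) (q : K).
Hypothesis q0 : q != 0.

Lemma skew_letters_on (A : algType K) (m : nat) (U : {set 'I_m}) :
  exists (E : algType K) (iota : {lrmorphism A -> E}) xi,
  [/\ qskew q xi, central_letters iota xi, (forall i : 'I_m, i \notin U -> xi i = 0) &
      forall z w, lprod xi (enum U) * iota z = lprod xi (enum U) * iota w -> z = w].
Proof.
have [E [iota [xi [eta [lp cx ce z0 inj]]]]] := letters_on q0 A U.
exists E, iota, xi; split=> // [|i /z0[]//|z w e]; first exact: lp_xi lp.
by apply: inj; rewrite -!mulrA !(central_lprod _ _ ce) !mulrA e.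
Qed.

(** With the letters outside [J] set to 0, a single term of [lprod_rowsum] is left. *)
Lemma lprod_rowsum_on (A E : algType K) (iota : {lrmorphism A -> E}) (k m : nat)
    (x : 'I_k -> 'I_m -> A) (xi : 'I_m -> E) (I : {set 'I_k}) (J : {set 'I_m}) :
  qskew q xi -> central_letters iota xi -> (forall j, j \notin J -> xi j = 0) ->
  #|I| = #|J| ->
  lprod (rowsum iota x xi) (enum I) = lprod xi (enum J) * iota (minor q x I J).
Proof.
move=> sk cx z0 e;
  rewrite (lprod_rowsum q0) // (bigD1 J) ?e //= big1 ?addr0 // => L /andP[/eqP cL nL].
have /subsetPn[j jL jJ] : ~~ (L \subset J).
  by apply: contra nL => sL; rewrite eqEcard sL cL leqnn.
have [c _ ->] := lprod_perm q0 sk (perm_to_rem (etrans (mem_enum _ _) jL)).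
by rewrite lprod_cons z0 // mul0r scaler0 mul0r.
Qed.

(** The quantum binomial theorem, cut off after the term linear in [a] because [a * a = 0]. *)
Lemma qbinom_exp (E : algType K) (p : K) (a b : E) (n : nat) :
  a * a = 0 -> b * a = p *: (a * b) ->
  (a + b) ^+ n.+1 = b ^+ n.+1 + (\sum_(i < n.+1) p ^+ i) *: (a * b ^+ n).
Proof.
move=> aa ba; elim: n => [|n IH].
  by rewrite !expr1 big_ord1 expr0 expr0 mulr1 scale1r addrC.
rewrite exprS IH mulrDl !mulrDr -!scalerAr mulrA aa mul0r scaler0 addr0 -exprS.
rewrite mulrA ba -scalerAl -mulrA -exprS scalerA addrCA; congr (_ + _).
rewrite -{1}[a * _]scale1r -scalerDl [in RHS]big_ord_recl expr0 mulr_suml; congr ((_ + _) *: _).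
by apply: eq_bigr => i _; rewrite exprSr.
Qed.

(** The quantum factorial, a product of quantum integers 1 + p + ... + p^i. *)
Definition qfact (p : K) (n : nat) : K := \prod_(i < n) \sum_(j < i.+1) p ^+ j.

Lemma qfact_neq0 (p : K) (n : nat) :
  (forall i, (0 < i)%N -> p ^+ i != 1) -> qfact p n != 0.
Proof.
move=> hp; apply/prodf_neq0 => i _; apply: contra (hp i.+1 isT) => /eqP e.
by rewrite -subr_eq0 subrX1 e mulr0.
Qed.

(** Induction peels off the smallest letter with [qbinom_exp]. The vanishing of the next power is
    carried along because it removes the term free of that letter. *)
Lemma sum_exp_qfact (E : algType K) (k : nat) (p : K) (w : 'I_k -> E) (s : seq 'I_k) :
  (forall i, w i * w i = 0) ->
  (forall i j : 'I_k, (i < j)%N -> w j * w i = p *: (w i * w j)) ->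
  uniq s -> sorted (@leI k) s ->
  (\sum_(i <- s) w i) ^+ size s = qfact p (size s) *: lprod w s /\
  (\sum_(i <- s) w i) ^+ (size s).+1 = 0.
Proof.
move=> ww wc; elim: s => [|i s IH] /=.
  by rewrite big_nil !expr0 expr1 /qfact big_ord0 scale1r lprod_nil.
move=> /andP[iNs us] ss; have [e0 e1] := IH us (path_sorted ss).
have tr : transitive (@leI k) by move=> a b c; exact: leq_trans.
rewrite big_cons; have sw : (\sum_(j <- s) w j) * w i = p *: (w i * (\sum_(j <- s) w j)).
  rewrite mulr_suml mulr_sumr scaler_sumr big_seq [RHS]big_seq; apply: eq_bigr => j js.
  apply: wc; rewrite ltn_neqAle (inj_eq val_inj).
  have /allP /(_ _ js) le := order_path_min tr ss.
  by rewrite (le : (i <= j)%N) andbT; apply: contra iNs => /eqP ->.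
rewrite !(qbinom_exp _ (ww i) sw) e1 exprS e1 mulr0 e0 mulr0 scaler0 !add0r; split=> //.
by rewrite -scalerAr scalerA lprod_cons /qfact [in RHS]big_ord_recr /= mulrC.
Qed.

Lemma lprod_mul (E : algType K) (k : nat) (u v : 'I_k -> E) (s : seq 'I_k) :
  (forall i j, v i * u j = u j * v i) ->
  lprod (fun i => u i * v i) s = lprod u s * lprod v s.
Proof.
move=> c; elim: s => [|i s IH]; first by rewrite !lprod_nil mulr1.
rewrite !lprod_cons IH -!mulrA; congr (_ * _); rewrite !mulrA; congr (_ * _).
by apply: commr_prod => j _; exact: c.
Qed.
End SkewPowers.

(** * Minors of the transposed matrix *)

Section Transpose.
Variables (K : fieldType) (q : K).
Hypothesis q0 : q != 0.

Definition trx (A : Type) (k m : nat) (x : 'I_k -> 'I_m -> A) : 'I_m -> 'I_k -> A :=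
  fun j i => x i j.

Lemma qmat_rel_tr (A : algType K) (k m : nat) (x : 'I_k -> 'I_m -> A) :
  qmat_rel q x -> qmat_rel q (trx x).
Proof.
case=> hc hr hm hx; split=> *; rewrite /trx.
- exact: hr.
- exact: hc.
- by apply/esym; exact: hm.
- by rewrite hx //; congr (_ + _ *: _); exact/esym/hm.
Qed.

Lemma qskew_lift (A E : algType K) (f : {lrmorphism A -> E}) (n : nat) (xi : 'I_n -> A) :
  qskew q xi -> qskew q (f \o xi).
Proof.
case=> sq sw; split=> [i|i j ij] /=; first by rewrite -rmorphM sq rmorph0.
have -> : f (xi j) * f (xi i) = f (xi j * xi i) by rewrite rmorphM.
by rewrite (sw _ _ ij) linearZ_LR rmorphM.
Qed.

Hypothesis hq : forall n, (0 < n)%N -> q ^+ n != 1.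

(** As the two families commute with each other, the products [u i * v i] square to 0 and commute up
    to the square of [- q^-1], where the signs cancel. *)
Lemma skew_mul_exp (E : algType K) (k : nat) (u v : 'I_k -> E) (S : {set 'I_k}) :
  qskew q u -> qskew q v -> (forall i j, v i * u j = u j * v i) ->
  (forall i, i \notin S -> u i = 0) ->
  (\sum_i u i * v i) ^+ #|S| =
    qfact (q^-1 ^+ 2) #|S| *: (lprod u (enum S) * lprod v (enum S)).
Proof.
move=> [su wu] [sv wv] c z0; rewrite -lprod_mul //.
have -> : \sum_i u i * v i = \sum_(i <- enum S) u i * v i.
  rewrite big_enum [LHS](bigID (mem S)) /= [X in _ + X]big1 ?addr0 // => i iS.
  by rewrite z0 // mul0r.
have c2 i j : u i * v i * (u j * v j) = u i * u j * (v i * v j).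
  by rewrite -!mulrA; congr (_ * _); rewrite !mulrA c.
rewrite cardE; apply: (sum_exp_qfact _ _ (enum_uniq S) (sorted_enum S)).1 => [i|i j ij].
  by rewrite c2 su mul0r.
by rewrite !c2 wu // wv // -!(scalerAl, scalerAr) scalerA mulrNN.
Qed.

(* With skew letters th for the rows and zeta for the columns, the power
   (\sum_(r, j) th_r zeta_j x_(r, j))^|I| is [|I|]! th_I zeta_J times either of
   the two minors. *)
Lemma minor_tr (A : algType K) (k m : nat) (x : 'I_k -> 'I_m -> A)
    (I : {set 'I_k}) (J : {set 'I_m}) :
  qmat_rel q x -> #|I| = #|J| -> minor q (trx x) J I = minor q x I J.
Proof.
move=> hx c.
(* The row letters are adjoined on top of the algebra that already contains the column letters, so
   the two families commute. *)
have [E1 [i1 [ze [skz cz z0 injz]]]] := skew_letters_on q0 A J.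
have [E2 [i2 [th [skt ct t0 injt]]]] := skew_letters_on q0 E1 I.
pose iota : {lrmorphism A -> E2} := i2 \o i1.
pose zeta : 'I_m -> E2 := i2 \o ze.
have skz' : qskew q zeta by exact: qskew_lift.
have cz' : central_letters iota zeta by move=> j a /=; rewrite /zeta /= -!rmorphM cz.
have ct' : central_letters iota th by move=> j a; exact: ct.
have tz i j : zeta j * th i = th i * zeta j by rewrite /zeta /= ct.
pose X := rowsum iota x zeta; pose Z := rowsum iota (trx x) th.
have skX : qskew q X by exact: qskew_rowsum.
have skZ : qskew q Z by apply: qskew_rowsum => //; exact: qmat_rel_tr.
have tX i j : X i * th j = th j * X i.
  by apply/esym/commr_sum => l _; apply: commrM; [exact/esym/tz|exact: ct'].
have zZ i j : Z i * zeta j = zeta j * Z i.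
  by apply/esym/commr_sum => l _; apply: commrM; [exact: tz|exact: cz'].
(* The same double sum, read by rows and by columns. *)
have eOm : \sum_r th r * X r = \sum_j zeta j * Z j.
  rewrite /X /Z /rowsum; under eq_bigr do rewrite mulr_sumr.
  rewrite exchange_big; apply: eq_bigr => j _; rewrite mulr_sumr.
  by apply: eq_bigr => r _; rewrite !mulrA tz.
have zeta0 j : j \notin J -> zeta j = 0 by move=> /z0; rewrite /zeta /= => ->; rewrite rmorph0.
have e1 := skew_mul_exp skt skX tX t0.
have e2 := skew_mul_exp skz' skZ zZ zeta0.
have pn i : (0 < i)%N -> q^-1 ^+ 2 ^+ i != 1.
  move=> i0; rewrite -exprM exprVn invr_eq1; apply: hq.
  by rewrite muln_gt0.
have lz : lprod zeta (enum J) = i2 (lprod ze (enum J)).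
  by rewrite /lprod rmorph_prod.
move: e1; rewrite eOm c e2 (lprod_rowsum_on q0 x skz' cz' zeta0 c) (lprod_rowsum_on q0 (trx
  x) skt ct' t0 (esym c)).
move/(scalerI (qfact_neq0 _ pn)).
have e3 a : lprod zeta (enum J) * iota a = i2 (lprod ze (enum J) * i1 a).
  by rewrite rmorphM lz.
have -> : lprod zeta (enum J) * (lprod th (enum I) * iota (minor q (trx x) J I)) =
    lprod th (enum I) * (lprod zeta (enum J) * iota (minor q (trx x) J I)).
  by rewrite !mulrA; congr (_ * _); rewrite lz (central_lprod _ _ ct).
by rewrite !e3 => /injt/injz.
Qed.
End Transpose.

(** * Exchange when one column set contains the other *)

Section Straddle.
Variables (K : fieldType) (q : K).
Hypothesis q0 : q != 0.

Lemma scale_expr_cancel (V : lmodType K) (a b : nat) (u v : V) :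
  (b <= a)%N -> q ^+ b *: u = q ^+ a *: v -> u = q ^+ (a - b) *: v.
Proof.
move=> ba e; have qb : q ^+ b != 0 by rewrite expf_neq0.
by apply: (scalerI qb); rewrite scalerA -exprD subnKC.
Qed.

(* Splitting R at [p] leaves two row sets L, H to which [minor_exchange]
   applies, with opposite roles. *)
Lemma minor_straddle (A : algType K) (k m : nat) (x : 'I_k -> 'I_m -> A)
    (R C : {set 'I_k}) (Q D : {set 'I_m}) (p : nat) :
  qmat_rel q x -> #|R| = #|Q| -> #|C| = #|D| -> Q \subset D ->
  (forall i j, i \in C :\: R -> j \in R :\: C -> (p <= j)%N -> (i < j)%N) ->
  (forall i j, i \in C :\: R -> j \in R :\: C -> (j < p)%N -> (j < i)%N) ->
  q ^+ #|[set j in R :\: C | (p <= j)%N]| *: (minor q x C D * minor q x R Q) =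
  q ^+ #|[set j in R :\: C | (j < p)%N]| *: (minor q x R Q * minor q x C D).
Proof.
move=> hx cRQ cCD sQD hi lo.
pose H := [set j in R | (p <= j)%N]; pose L := [set j in R | (j < p)%N].
have eH : [set j in R :\: C | (p <= j)%N] = H :\: C.
  by apply/setP => j; rewrite !inE andbA.
have eL : [set j in R :\: C | (j < p)%N] = L :\: C.
  by apply/setP => j; rewrite !inE andbA.
rewrite eH eL.
(* The column condition of [minor_exchange] is vacuous because [J] lies in [D]. A row of [C] outside
   [H] either is not in [R], where [hi] applies, or is in [R] and below [p]. *)
have mH (J : {set 'I_m}) : J \subset Q -> #|J| = #|H| ->
    minor q x H J * minor q x C D = q ^+ #|H :\: C| *: (minor q x C D * minor q x H J).
  move=> sJ cJ; rewrite cardsD; apply: scale_expr_cancel.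
    by rewrite subset_leq_card ?subsetIl.
  have := @minor_exchange _ _ q0 A k m x C H D J hx cCD (esym cJ) _ _.
  rewrite (setIidPr (subset_trans sJ sQD)) cJ setIC; apply.
    move=> i j; rewrite !inE => /andP[iH iC] /andP[jC /andP[jR pj]].
    case: (boolP (i \in R)) iH => [iR|iR _] /=; last by apply: hi; rewrite ?inE ?iR ?iC ?jC ?jR.
    by rewrite -ltnNge => ip; exact: leq_trans ip pj.
  move=> i j; rewrite inE => /andP[iD iJ]; case/negP: iD.
  exact: (subsetP (subset_trans sJ sQD)).
have mL (J : {set 'I_m}) : J \subset Q -> #|J| = #|L| ->
    minor q x C D * minor q x L J = q ^+ #|L :\: C| *: (minor q x L J * minor q x C D).
  move=> sJ cJ; rewrite cardsD; apply: scale_expr_cancel.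
    by rewrite subset_leq_card ?subsetIl.
  have := @minor_exchange _ _ q0 A k m x L C J D hx (esym cJ) cCD _ _.
  rewrite (setIidPl (subset_trans sJ sQD)) cJ; apply.
    move=> j i; rewrite !inE => /andP[jC /andP[jR pj]] /andP[iL iC].
    case: (boolP (i \in R)) iL => [iR|iR _] /=; last by apply: lo; rewrite ?inE ?iR ?iC ?jC ?jR.
    by rewrite -leqNgt => ip; exact: leq_trans pj ip.
  move=> i j _; rewrite inE => /andP[jD jJ]; case/negP: jD.
  exact: (subsetP (subset_trans sJ sQD)).
have [E [iota [xi [skx cx z0 inj]]]] := skew_letters_on q0 A Q.
pose X := rowsum iota x xi; have skX : qskew q X by exact: qskew_rowsum.
pose W := iota (minor q x C D).
(* A commutation rule shared by all minors on rows [S] with columns in [Q] passes to the row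
   product, since the other letters vanish. *)
have comm (S : {set 'I_k}) (a b : K) :
    (forall J : {set 'I_m}, J \subset Q -> #|J| = #|S| ->
      a *: (minor q x C D * minor q x S J) = b *: (minor q x S J * minor q x C D)) ->
    a *: (W * lprod X (enum S)) = b *: (lprod X (enum S) * W).
  move=> h; rewrite (lprod_rowsum q0 x) // mulr_sumr mulr_suml !scaler_sumr.
  apply: eq_bigr => J /eqP cJ.
  case: (boolP (J \subset Q)) => [sJ|/subsetPn[j jJ jQ]]; last first.
    have [c _ ->] := lprod_perm q0 skx (perm_to_rem (etrans (mem_enum _ _) jJ)).
    by rewrite lprod_cons z0 // mul0r scaler0 !mul0r mulr0 !scaler0.
  rewrite mulrA -(central_lprod _ _ cx) -!mulrA -!rmorphM !scalerAr -!linearZ_LR /=.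
  by rewrite h.
have eX : propto (lprod X (enum R)) (lprod X (enum L) * lprod X (enum H)).
  rewrite -lprod_cat; apply: (lprod_perm q0 skX); apply: uniq_perm;
    rewrite ?cat_uniq ?enum_uniq //=.
    rewrite andbT; apply/hasPn => i; rewrite /= !mem_enum !inE => /andP[_ pi].
    by rewrite ltnNge pi andbF.
  by move=> i; rewrite mem_cat !mem_enum !inE; case: (i \in R) => //=; case: ltnP.
have [c c0 {}eX] := eX.
have e : q ^+ #|H :\: C| *: (W * lprod X (enum R)) = q ^+ #|L :\: C| *: (lprod X (enum R) * W).
  have hL : 1 *: (W * lprod X (enum L)) = q ^+ #|L :\: C| *: (lprod X (enum L) * W).
    by apply: comm => J sJ cJ; rewrite scale1r mL.
  have hH : q ^+ #|H :\: C| *: (W * lprod X (enum H)) = 1 *: (lprod X (enum H) * W).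
    by apply: comm => J sJ cJ; rewrite scale1r mH.
  rewrite !scale1r in hL hH.
  rewrite eX -!(scalerAl, scalerAr) mulrA hL -scalerAl -(mulrA _ W) -(mulrA _ _ W) -hH.
  rewrite -!scalerAr !scalerA; congr (_ *: _); ring.
move: e; rewrite (lprod_rowsum_on q0 x skx cx z0 cRQ) /W.
rewrite mulrA -(central_lprod _ _ cx) -!mulrA => e; apply: inj.
by rewrite !linearZ !rmorphM -!scalerAr.
Qed.
End Straddle.

(** * Products of minors are nonzero *)

Section RowOperation.
Variables (K : fieldType) (q : K).
Hypothesis q0 : q != 0.

Section RowPairs.
Variables (A : algType K) (m : nat).
Implicit Types (u v w : 'I_m -> A).

Definition row_rel u : Prop :=
  forall j t : 'I_m, (j < t)%N -> u t * u j = q *: (u j * u t).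

Definition row_pair_rel u v : Prop :=
  [/\ forall j, v j * u j = q *: (u j * v j),
      forall j t : 'I_m, (t < j)%N -> v t * u j = u j * v t &
      forall j t : 'I_m, (j < t)%N -> v t * u j = u j * v t + (q - q^-1) *: (u t * v j)].

Lemma qmat_rel_rows (k : nat) (x : 'I_k -> 'I_m -> A) :
  qmat_rel q x <-> (forall i, row_rel (x i)) /\
    (forall i s : 'I_k, (i < s)%N -> row_pair_rel (x i) (x s)).
Proof.
split=> [[hc hr hm hx]|[hr hp]].
  split=> [i j t|i s is_]; first exact: hr.
  split=> [j|j t|j t]; [exact: hc|exact: hm|exact: hx].
split=> [i s j lt|i j t|i s j t lt|i s j t lt].
- by have [+ _ _] := hp _ _ lt; apply.
- exact: hr.
- by have [_ + _] := hp _ _ lt; apply.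
- by have [_ _ +] := hp _ _ lt; apply.
Qed.

Lemma row_pair_addr u v w :
  row_pair_rel u v -> row_pair_rel u w -> row_pair_rel u (fun j => v j + w j).
Proof.
move=> [a1 a2 a3] [b1 b2 b3]; split=> [j|j t lt|j t lt].
- by rewrite mulrDl mulrDr a1 b1 scalerDr.
- by rewrite mulrDl mulrDr a2 // b2.
- by rewrite mulrDl !mulrDr a3 // b3 // scalerDr addrACA.
Qed.

Lemma row_pair_addl u v w :
  row_pair_rel u w -> row_pair_rel v w -> row_pair_rel (fun j => u j + v j) w.
Proof.
move=> [a1 a2 a3] [b1 b2 b3]; split=> [j|j t lt|j t lt].
- by rewrite mulrDl mulrDr a1 b1 scalerDr.
- by rewrite mulrDl mulrDr a2 // b2.
- by rewrite mulrDr !mulrDl a3 // b3 // scalerDr addrACA.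
Qed.
End RowPairs.

Section Tensor.
Variables (A : algType K) (m n : nat).
Implicit Types (u v : 'I_m -> A) (s t : 'M[K]_n.+1).

Lemma row_rel_tens u s : row_rel u -> row_rel (fun j => tens (u j) s).
Proof. by move=> h i j ij; rewrite !tensM h // tensZl. Qed.

Lemma row_pair_tens u v s t : s * t = t * s ->
  row_pair_rel u v -> row_pair_rel (fun j => tens (u j) s) (fun j => tens (v j) t).
Proof.
move=> st [a1 a2 a3]; split=> [i|i j ij|i j ij]; rewrite !tensM.
- by rewrite a1 st tensZl.
- by rewrite a2 // st.
- by rewrite a3 // st tensDl tensZl.
Qed.

(** The cross relation reduces to q^2 = 1 + (q - q^-1) q. *)
Lemma row_pair_tens_self u s t : t * s = q *: (s * t) ->
  row_rel u -> row_pair_rel (fun j => tens (u j) s) (fun j => tens (u j) t).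
Proof.
move=> st a; split=> [i|i j ij|i j ij]; rewrite !tensM st tensZr //.
  by rewrite (a j i ij) tensZl.
by rewrite (a i j ij) !tensZl !scalerA -[X in _ = X + _]scale1r -scalerDl; congr (_ *: _);
  field.
Qed.

Lemma row_rel_tens_add u v s t : s * t = q *: (t * s) ->
  row_rel u -> row_rel v -> row_pair_rel u v ->
  row_rel (fun j => tens (v j) s + tens (u j) t).
Proof.
move=> st au av [b1 b2 b3] i j ij.
rewrite !mulrDl !mulrDr !tensM (av _ _ ij) (au _ _ ij) (b3 _ _ ij) (b2 _ _ ij) st.
rewrite !tensZr tensDl !tensZl.
set P := tens (u i * v j) _; set Q := tens (u j * v i) _.
set X := tens _ (s * s); set Y := tens _ (t * t).
rewrite !scalerDr !scalerA -!addrA; congr (_ + _).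
rewrite [RHS]addrCA; congr (_ + _); rewrite addrA; congr (_ + _).
by rewrite -{2}[Q]scale1r -scalerDl; congr (_ *: _); field.
Qed.
End Tensor.

(* A truncated q-Weyl algebra: h t = q t h and g = h^-1. *)
Definition shift_g : 'M[K]_3 := \matrix_(i, j) (if i == j then q ^+ i else 0).
Definition shift_h : 'M[K]_3 := \matrix_(i, j) (if i == j then q ^- i else 0).
Definition shift_t : 'M[K]_3 := \matrix_(i, j) (if j == i.+1 :> nat then 1 else 0).

Lemma shift_gh : shift_g * shift_h = 1.
Proof.
apply/matrixP => i j; rewrite !mxE (bigD1 i) //= big1 ?addr0 => [|l li]; last first.
  by rewrite !mxE eq_sym (negPf li) mul0r.
rewrite !mxE eqxx; case: eqP => [->|_]; last by rewrite mulr0.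
by rewrite mulfV // expf_neq0.
Qed.

Lemma shift_hg : shift_h * shift_g = 1.
Proof.
apply/matrixP => i j; rewrite !mxE (bigD1 i) //= big1 ?addr0 => [|l li]; last first.
  by rewrite !mxE eq_sym (negPf li) mul0r.
rewrite !mxE eqxx; case: eqP => [->|_]; last by rewrite mulr0.
by rewrite mulVf // expf_neq0.
Qed.

Lemma shift_tg : shift_t * shift_g = q *: (shift_g * shift_t).
Proof.
apply/matrixP => i j; rewrite !mxE (bigD1 j) //= big1 ?addr0 => [|l li]; last first.
  by rewrite !mxE (negPf li) mulr0.
rewrite (bigD1 i) //= big1 ?addr0 => [|l li]; last first.
  by rewrite !mxE eq_sym (negPf li) mul0r.
rewrite !mxE !eqxx; case: eqP => [->|_]; last by rewrite mul0r !mulr0.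
by rewrite mul1r mulr1 exprS.
Qed.

Lemma shift_ht : shift_h * shift_t = q *: (shift_t * shift_h).
Proof.
apply: (can_inj (mulKr (_ : shift_g \is a GRing.unit))).
  by apply/unitrP; exists shift_h; rewrite shift_gh shift_hg.
rewrite mulrA shift_gh mul1r -[LHS]mulr1 -shift_gh mulrA shift_tg.
by rewrite -!(scalerAl, scalerAr) mulrA.
Qed.

Section RowOp.
Variables (A : algType K) (k m : nat) (x : 'I_k -> 'I_m -> A) (p p1 : 'I_k).
Hypotheses (hx : qmat_rel q x) (pp1 : p1 = p.+1 :> nat).

(** The relation [shift_tg] lets row [p] pair with its multiple added to row [p1], [shift_ht] keeps
    row [p1] compatible with itself, and [shift_g] commutes with [shift_h], which preserves the
    original pairing. *)
Definition row_op (i : 'I_k) (j : 'I_m) : mxalg A 2 :=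
  if i == p then tens (x p j) shift_g else
  if i == p1 then tens (x p1 j) shift_h + tens (x p j) shift_t else mxscal 2 (x i j).

Lemma qmat_rel_row_op : qmat_rel q row_op.
Proof.
have [hr hp] := (qmat_rel_rows x).1 hx.
have gh : shift_g * shift_h = shift_h * shift_g by rewrite shift_gh shift_hg.
have lt01 : (p < p1)%N by rewrite pp1.
have ne : p1 == p = false by apply/negbTE; rewrite -val_eqE /= pp1 neq_ltn ltnSn orbT.
apply/qmat_rel_rows; split=> [i|i s is_]; rewrite /row_op.
  case: eqP => _; first exact: row_rel_tens.
  case: eqP => _; last exact: row_rel_tens.
  by apply: row_rel_tens_add => //; [exact: shift_ht|exact: hp].
have c1 (M : 'M[K]_3) : 1 * M = M * 1 by rewrite mul1r mulr1.
case: (eqVneq i p) is_ => [->|ip] is_.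
  have -> : s == p = false by apply/negbTE; rewrite -val_eqE neq_ltn is_ orbT.
  case: eqP => [_|sp1]; last by apply: row_pair_tens => //; exact: hp.
  apply: row_pair_addr; first by apply: row_pair_tens => //; exact: hp.
  by apply: row_pair_tens_self => //; exact: shift_tg.
case: (eqVneq i p1) is_ => [->|ip1] is_.
  have ps := ltn_trans lt01 is_.
  have -> : s == p = false by apply/negbTE; rewrite -val_eqE neq_ltn ps orbT.
  have -> : s == p1 = false by apply/negbTE; rewrite -val_eqE neq_ltn is_ orbT.
  by apply: row_pair_addl; apply: row_pair_tens => //; exact: hp.
case: (eqVneq s p) is_ => [->|sp] is_; first by apply: row_pair_tens => //; exact: hp.
case: (eqVneq s p1) is_ => [->|sp1] is_; last by apply: row_pair_tens => //; exact: hp.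
apply: row_pair_addr; apply: row_pair_tens => //; apply: hp => //.
by move: is_; rewrite pp1 ltnS leq_eqVlt val_eqE (negPf ip).
Qed.

End RowOp.
End RowOperation.

Section MinorRowOp.
Variables (K : fieldType).

(** The compression of set systems that replaces [p1] by [p] when possible. *)
Definition lower (k : nat) (p p1 : 'I_k) (S : {set 'I_k}) : {set 'I_k} :=
  if (p1 \in S) && (p \notin S) then p |: (S :\ p1) else S.

Lemma card_lower (k : nat) (p p1 : 'I_k) (S : {set 'I_k}) : #|lower p p1 S| = #|S|.
Proof.
rewrite /lower; case: ifP => // /andP[s1 sp].
rewrite cardsU1 !inE (negPf sp) andbF /= add1n.
by rewrite (cardsD1 p1 S) s1.
Qed.

(* [u] is the leading coefficient of [M], of degree [d] in the shift
   [shift_t]; leading coefficients multiply as long as d + e < 3. *)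
Definition top_band (A : algType K) (M : (mxalg A 2 : algType K)) (d : nat) (u : A) : Prop :=
  (forall i j : 'I_3, ((j < i) || (i + d < j))%N -> M i j = 0) /\
  (forall i j : 'I_3, (j = i + d :> nat)%N -> propto (M i j) u).

Lemma top_band_mul (A : algType K) (M N : (mxalg A 2 : algType K)) (d e : nat) (u v : A) :
  (d <= 1)%N -> (e <= 1)%N -> top_band M d u -> top_band N e v -> M * N = 0 -> u * v = 0.
Proof.
move=> d1 e1 [M0 Mu] [N0 Nv] MN.
have dlt : (d < 3)%N by lia.
have delt : (d + e < 3)%N by lia.
(* Only the index [d] contributes to the entry (0, d + e), so this entry is the product of the two
   leading coefficients up to a nonzero scalar. *)
have : (M * N) (@Ordinal 3 0 isT) (Ordinal delt) = 0 by rewrite MN mxE.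
rewrite mxE (bigD1 (Ordinal dlt)) //= big1 ?addr0 => [e0|i id]; last first.
  case: (ltngtP i d) => [lt|lt|eid]; last by rewrite -val_eqE /= eid eqxx in id.
    by rewrite N0 ?mulr0 //=; lia.
  by rewrite M0 ?mul0r //=; lia.
have [a a0 ea] := propto_sym (Mu (@Ordinal 3 0 isT) (Ordinal dlt) erefl).
have [b b0 eb] := propto_sym (Nv (Ordinal dlt) (Ordinal delt) erefl).
by rewrite ea eb -!(scalerAl, scalerAr) e0 !scaler0.
Qed.

Lemma top_band_diag (A : algType K) (M : (mxalg A 2 : algType K)) (u : A) (t : 'M[K]_3) :
  (forall i j, i != j -> t i j = 0) -> (forall i, t i i != 0) ->
  propto M (tens u t) -> top_band M 0 u.
Proof.
move=> t0 t1 [c c0 ->]; split=> i j; rewrite !mxE.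
  by rewrite addn0 -neq_ltn eq_sym => /t0 ->; rewrite scale0r scaler0.
rewrite addn0 => /val_inj ->; exists (c * t i i); first by rewrite mulf_neq0.
by rewrite scalerA.
Qed.

Lemma band1 (i j : nat) : (j < i)%N || (i + 1 < j)%N -> i != j /\ j != i.+1.
Proof. by lia. Qed.

Variable q : K.
Hypothesis q0 : q != 0.

(** If [S] contains both rows, the added multiple of row [p] repeats a skew letter and
    [shift_g * shift_h = 1]. If it contains only [p1], the lowered minor appears as the coefficient
    of [shift_t], in degree 1. If it contains only [p], the factor is [shift_g]; if neither, nothing
    changes. *)
Lemma minor_row_op (A : algType K) (k m : nat) (x : 'I_k -> 'I_m -> A) (p p1 : 'I_k)
    (S : {set 'I_k}) (J : {set 'I_m}) :
  qmat_rel q x -> p1 = p.+1 :> nat -> #|S| = #|J| ->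
  exists2 d, (d <= 1)%N & top_band (minor q (row_op q x p p1) S J) d (minor q x (lower p p1
    S) J).
Proof.
move=> hx pp1 cS; have hy := qmat_rel_row_op q0 hx pp1.
have [E [iota [xi [skx cx z0 inj]]]] := skew_letters_on q0 (mxalg A 2) J.
pose j0 : {lrmorphism A -> E} := iota \o (@mxscal K A 2).
have cx' : central_letters j0 xi by move=> j a; exact: cx.
pose X := rowsum j0 x xi; pose Y := rowsum iota (row_op q x p p1) xi.
have skX : qskew q X by exact: qskew_rowsum.
have skY : qskew q Y by exact: qskew_rowsum.
pose sc (t : 'M[K]_3) : E := iota (tens 1 t).
have ne : p1 == p = false by apply/negbTE; rewrite -val_eqE /= pp1 neq_ltn ltnSn orbT.
have scM s t : sc s * sc t = sc (s * t) by rewrite /sc -rmorphM tensM mulr1.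
have cX i t : sc t * X i = X i * sc t.
  apply: commr_sum => j _; apply: commrM; first exact/esym/cx.
  by rewrite /GRing.comm /j0 /= -!rmorphM /mxscal !tensM !mulr1 !mul1r.
have Yp : Y p = X p * sc (shift_g q).
  rewrite /Y /X /rowsum mulr_suml; apply: eq_bigr => j _.
  by rewrite /row_op eqxx -mulrA /= -rmorphM /mxscal tensM mulr1 mul1r.
have Yp1 : Y p1 = X p1 * sc (shift_h q) + X p * sc (shift_t K).
  rewrite /Y /X /rowsum !mulr_suml -big_split; apply: eq_bigr => j _ /=.
  by rewrite /row_op eqxx ne -!mulrA /= -!rmorphM /mxscal !tensM !mulr1 !mul1r rmorphD mulrDr.
have Yi i : i != p -> i != p1 -> Y i = X i.
  by move=> /negPf ip /negPf ip1; apply: eq_bigr => j _; rewrite /row_op ip ip1.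
have Ys s : p \notin s -> p1 \notin s -> lprod Y s = lprod X s.
  move=> sp sp1; rewrite /lprod big_seq [RHS]big_seq; apply: eq_bigr => i si.
  by apply: Yi; [apply: contra sp|apply: contra sp1] => /eqP <-.
have cXs s t : sc t * lprod X s = lprod X s * sc t by apply: commr_prod => i _; exact: cX.
have rX (T : {set 'I_k}) : #|T| = #|J| -> lprod X (enum T) = lprod xi (enum J) * iota (mxscal
  2 (minor q x T J)).
  by move=> cT; rewrite (lprod_rowsum_on q0 x skx cx' z0 cT).
have rY : lprod Y (enum S) = lprod xi (enum J) * iota (minor q (row_op q x p p1) S J).
  exact: lprod_rowsum_on.
have scr u t : iota (mxscal 2 u) * sc t = iota (tens u t).
  by rewrite /sc -rmorphM /mxscal tensM mulr1 mul1r.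
have key (t : 'M[K]_3) : propto (lprod Y (enum S)) (lprod X (enum S) * sc t) ->
    propto (minor q (row_op q x p p1) S J) (tens (minor q x S J) t).
  rewrite rX // rY -mulrA scr => -[c c0]; rewrite scalerAr -linearZ => /inj e.
  by exists c.
have sc1 : sc 1 = 1 by rewrite /sc -[tens 1 1]/(mxscal 2 (1 : A)) !rmorph1.
have d1 (i j : 'I_3) : i != j -> (1 : 'M[K]_3) i j = 0 by move=> /negPf h; rewrite mxE h.
have d1' (i : 'I_3) : (1 : 'M[K]_3) i i != 0 by rewrite mxE eqxx oner_neq0.
pose s0 := enum (S :\ p :\ p1).
have s0p : p \notin s0 by rewrite mem_enum !inE eqxx andbF.
have s0p1 : p1 \notin s0 by rewrite mem_enum !inE eqxx.
have us0 : uniq s0 := enum_uniq _.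
rewrite /lower; case: (boolP (p1 \in S)) => /= Sp1; case: (boolP (p \in S)) => /= Sp.
- exists 0 => //; apply: top_band_diag d1 d1' _; apply: key; rewrite sc1 mulr1.
  have ps : perm_eq (enum S) [:: p, p1 & s0].
    apply: uniq_perm; first exact: enum_uniq.
      by rewrite /= inE eq_sym ne s0p s0p1.
    move=> i; rewrite !inE !mem_enum !inE; case: (eqVneq i p) => [->|ip]; first by rewrite Sp.
    by case: (eqVneq i p1) => [->|ip1].
  apply: propto_trans (lprod_perm q0 skY ps) _.
  apply: propto_trans (propto_sym (lprod_perm q0 skX ps)).
  rewrite !lprod_cons Ys // Yp Yp1 !mulrA mulrDr -!(mulrA (X p)) !(mulrA (sc _)) !cX.
  rewrite -!mulrA !scM shift_gh // sc1 mulr1 !mulrA skX.1 !mul0r addr0.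
  exact: propto_refl.
- exists 1%N => //.
  have ps : perm_eq (enum S) (p1 :: s0).
    apply: uniq_perm; rewrite ?enum_uniq //= ?s0p1 // => i.
    rewrite !inE !mem_enum !inE; case: (eqVneq i p) => [->|ip];
      first by rewrite (negPf Sp) eq_sym ne.
    by case: (eqVneq i p1) => [->|ip1].
  have ps' : perm_eq (enum (p |: S :\ p1)) (p :: s0).
    apply: uniq_perm; rewrite ?enum_uniq //= ?s0p // => i.
    by rewrite !inE !mem_enum !inE; case: (eqVneq i p).
  have cS' : #|p |: S :\ p1| = #|J|.
    by rewrite -cS -(card_lower p p1 S) /lower Sp1 Sp.
  have [c c0 ec] := lprod_perm q0 skY ps.
  have [a a0 ea] := propto_sym (lprod_perm q0 skX ps).
  have [b b0 eb] := propto_sym (lprod_perm q0 skX ps').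
  have : minor q (row_op q x p p1) S J =
      (c * a) *: tens (minor q x S J) (shift_h q) +
      (c * b) *: tens (minor q x (p |: S :\ p1) J) (shift_t K).
    apply: inj;
      rewrite -rY linearD !linearZ /= -(scr (minor q x S J)) -(scr (minor q x _ J)) mulrDr
        -!scalerAr !(mulrA (lprod xi _)).
    rewrite -!rX // -!(scalerA c) -scalerDr ec; congr (_ *: _).
    rewrite !scalerAl -ea -eb !lprod_cons Ys // Yp1 mulrDl.
    by rewrite -!mulrA !cXs !mulrA.
  move=> ->; split=> i j; rewrite !mxE.
    by move=> /band1 [/negPf ij /negPf ji]; rewrite -val_eqE ij ji !scale0r !scaler0 addr0.
  rewrite addn1 => ji; rewrite ji eqxx.
  have /negPf -> : i != j by rewrite -val_eqE /= ji neq_ltn ltnSn.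
  by rewrite scale0r scaler0 add0r scale1r; exists (c * b) => //; rewrite mulf_neq0.
- exists 0 => //; apply: (@top_band_diag _ _ _ (shift_g q)).
  + by move=> i j /negPf h; rewrite mxE h.
  + by move=> i; rewrite mxE eqxx expf_neq0.
  apply: key.
  have ps : perm_eq (enum S) (p :: s0).
    apply: uniq_perm; rewrite ?enum_uniq //= ?s0p // => i.
    rewrite !inE !mem_enum !inE; case: (eqVneq i p) => [->|ip]; first by rewrite Sp.
    by case: (eqVneq i p1) => [->|ip1] //; rewrite (negPf Sp1).
  apply: propto_trans (lprod_perm q0 skY ps) _.
  apply: propto_trans (proptoM (propto_sym (lprod_perm q0 skX ps)) (propto_refl _)).
  rewrite !lprod_cons Ys // Yp -!mulrA cXs; exact: propto_refl.
- exists 0 => //; apply: top_band_diag d1 d1' _; apply: key; rewrite sc1 mulr1.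
  by rewrite Ys ?mem_enum //; exact: propto_refl.
Qed.
End MinorRowOp.

(** * Descent to initial row and column sets *)

Section Nonvanishing.
Variables (K : fieldType) (q : K).
Hypothesis q0 : q != 0.

(* All algebras at once, because a row operation changes the algebra. *)
Definition vanishing (k m : nat) (S T : {set 'I_k}) (J L : {set 'I_m}) : Prop :=
  forall (A : algType K) (x : 'I_k -> 'I_m -> A),
    qmat_rel q x -> minor q x S J * minor q x T L = 0.

Lemma vanishing_lower (k m : nat) (S T : {set 'I_k}) (J L : {set 'I_m}) (p p1 : 'I_k) :
  p1 = p.+1 :> nat -> #|S| = #|J| -> #|T| = #|L| ->
  vanishing S T J L -> vanishing (lower p p1 S) (lower p p1 T) J L.
Proof.
move=> pp1 cS cT v A x hx.
have [d d1 bS] := minor_row_op q0 hx pp1 cS.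
have [e e1 bT] := minor_row_op q0 hx pp1 cT.
have h := v _ _ (qmat_rel_row_op q0 hx pp1).
exact: (top_band_mul d1 e1 bS bT h).
Qed.

Definition initial (k : nat) (S : {set 'I_k}) : bool :=
  [forall p : 'I_k, forall p1 : 'I_k, (p1 == p.+1 :> nat) && (p1 \in S) ==> (p \in S)].

(** Downward closed sets are initial segments, by comparing cardinalities with
    [[set j : 'I_k | (j < n)%N]]. *)
Lemma initial_mem (k : nat) (S : {set 'I_k}) (i : 'I_k) :
  initial S -> (i \in S) = (i < #|S|)%N.
Proof.
move=> iS.
have down (j l : 'I_k) : (l <= j)%N -> j \in S -> l \in S.
  move=> /subnKC; move: (j - l)%N => d; elim: d j l => [|d IH] j l e Sj.
    by rewrite (_ : l = j) //; apply: val_inj; rewrite /= -e addn0.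
  have lt : (l.+1 < k)%N by apply: leq_ltn_trans (ltn_ord j); rewrite -e addnS ltnS leq_addr.
  have := IH j (Ordinal lt); rewrite /= addSnnS => /(_ e Sj) Sl.
  by have /forallP/(_ l)/forallP/(_ (Ordinal lt))/implyP := iS; apply; rewrite /= eqxx.
have cI (n : nat) : (n <= k)%N -> #|[set j : 'I_k | (j < n)%N]| = n.
  move=> nk; rewrite -sum1dep_card -(big_ord_widen k (fun=> 1%N) nk).
  by rewrite big_const_ord iter_addn_0 mul1n.
apply/idP/idP => [Si|].
  rewrite -[X in (X <= _)%N](cI i.+1 (ltn_ord i)); apply: subset_leq_card.
  by apply/subsetP => j; rewrite inE ltnS => ji; exact: down Si.
apply: contraLR => Si; rewrite -leqNgt -[X in (_ <= X)%N](cI i (ltnW (ltn_ord i))).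
apply: subset_leq_card; apply/subsetP => j Sj; rewrite inE ltnNge.
by apply: contra Si => ij; exact: down Sj.
Qed.

(** The measure for the descent: a lowering that changes the set decreases it by one. *)
Definition weight (k : nat) (S : {set 'I_k}) : nat := \sum_(i in S) i.

Lemma weight_lower (k : nat) (p p1 : 'I_k) (S : {set 'I_k}) :
  p1 = p.+1 :> nat -> (weight (lower p p1 S) + ((p1 \in S) && (p \notin S)) = weight S)%N.
Proof.
move=> pp1; rewrite /lower; case: ifP => [/andP[s1 sp]|_]; last by rewrite addn0.
rewrite /weight big_setU1 ?inE ?(negPf sp) ?andbF //= [RHS](big_setD1 p1) //= pp1 addn1 addSn.
by [].
Qed.

(** [S] and [T] must undergo the same lowering. Neither weight ever grows, and a gap in either set
    makes the total drop. *)
Lemma vanishing_initial (k m : nat) (S T : {set 'I_k}) (J L : {set 'I_m}) :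
  #|S| = #|J| -> #|T| = #|L| -> vanishing S T J L ->
  exists S' T' : {set 'I_k}, [/\ initial S', initial T', #|S'| = #|J|, #|T'| = #|L| &
    vanishing S' T' J L].
Proof.
move: (ltnSn (weight S + weight T)%N); move: {2}(_.+1) => w.
elim: w S T => [//|w IH] S T lew cS cT v.
have step (p p1 : 'I_k) : p1 = p.+1 :> nat ->
    ((p1 \in S) && (p \notin S)) || ((p1 \in T) && (p \notin T)) ->
    exists S' T' : {set 'I_k}, [/\ initial S', initial T', #|S'| = #|J|, #|T'| = #|L| &
      vanishing S' T' J L].
  move=> pp1 hor; apply: IH (vanishing_lower pp1 cS cT v); rewrite ?card_lower //.
  have := weight_lower S pp1; have := weight_lower T pp1; move: hor lew.
  by case: (_ && _); case: (_ && _) => //= _; rewrite ?addn1 ?addn0; lia.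
have viol (U : {set 'I_k}) : ~~ initial U ->
    exists p p1 : 'I_k, p1 = p.+1 :> nat /\ (p1 \in U) && (p \notin U).
  move=> /forallPn[p /forallPn[p1]]; rewrite negb_imply => /andP[/andP[/eqP e u] n].
  by exists p, p1; rewrite u n.
case: (boolP (initial S)) => iS; last first.
  by have [p [p1 [e h]]] := viol _ iS; apply: step e _; rewrite h.
case: (boolP (initial T)) => iT; last first.
  by have [p [p1 [e h]]] := viol _ iT; apply: step e _; rewrite h orbT.
by exists S, T.
Qed.

(** For the identity matrix the row sum [X i] is the letter [xi] of the same value, so the row
    product is a nonzero multiple of the product of the letters of [J]. *)
Lemma minor_identity (k m : nat) (S : {set 'I_k}) (J : {set 'I_m}) :
  #|S| = #|J| -> initial S -> initial J ->
  let x : 'I_k -> 'I_m -> K^o := fun i j => if i == j :> nat then 1 else 0 in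
  qmat_rel q x /\ minor q x S J != 0.
Proof.
move=> c iS iJ x.
have hx : qmat_rel q x.
  split=> [i s j lt|i j t lt|i s j t lt1 lt2|i s j t lt1 lt2]; rewrite /x.
  - by do 2!case: eqP => ?; rewrite ?(mulr0, mul0r, scaler0) //; lia.
  - by do 2!case: eqP => ?; rewrite ?(mulr0, mul0r, scaler0) //; lia.
  - exact: mulrC.
  - rewrite [in RHS]mulrC; case: (eqVneq (i : nat) t) => it;
    last by rewrite mul0r scaler0 addr0 mulrC.
    (* The correction term would require s = j < t = i < s. *)
    have /negPf -> : (s : nat) != j by lia.
    by rewrite mulr0 scaler0 addr0 mulrC.
split=> //.
have [E [iota [xi [skx cx z0 inj]]]] := skew_letters_on q0 (K^o : algType K) J.
pose X := rowsum iota x xi.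
have X1 (i : 'I_k) (j : 'I_m) : i = j :> nat -> X i = xi j.
  move=> ij; rewrite /X /rowsum (bigD1 j) //= big1 ?addr0 => [|l lj].
    by rewrite /x ij eqxx rmorph1 mulr1.
  by rewrite /x ij eq_sym val_eqE (negPf lj) rmorph0 mulr0.
pose t : seq 'I_m := pmap insub (map val (enum S)).
have eX : lprod X (enum S) = lprod xi t.
  have : all (mem S) (enum S) by apply/allP => i; rewrite mem_enum.
  rewrite /t; elim: (enum S) => [|i s IH] /=; first by rewrite !lprod_nil.
  move=> /andP[iSS /IH e]; rewrite lprod_cons e.
  have im : (i < m)%N.
    have := max_card (mem J); rewrite card_ord -c; apply: leq_trans.
    by rewrite -initial_mem.
  by rewrite insubT /= lprod_cons (X1 i (Ordinal im)).
have pt : perm_eq t (enum J).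
  apply: uniq_perm; rewrite ?enum_uniq //.
    by rewrite pmap_sub_uniq // map_inj_uniq ?enum_uniq //; exact: val_inj.
  move=> j; rewrite mem_pmap_sub mem_enum (initial_mem j iJ) -c.
  apply/mapP/idP => [[ i ]|lt]; first by rewrite mem_enum (initial_mem i iS) => ? ->.
  have jk : (j < k)%N by apply: leq_trans lt _; rewrite -[X in (_ <= X)%N]card_ord max_card.
  by exists (Ordinal jk) => //; rewrite mem_enum (initial_mem _ iS).
have [a a0 ea] := propto_sym (lprod_perm q0 skx pt).
apply/eqP => m0; have /eqP := oner_neq0 K; apply.
apply: (inj 1 0); rewrite rmorph0 mulr0 rmorph1 mulr1.
by rewrite ea -eX (lprod_rowsum_on q0 x skx cx z0 c) m0 rmorph0 mulr0 scaler0.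
Qed.

Hypothesis hq : forall n, (0 < n)%N -> q ^+ n != 1.

(** Rows are lowered first; transposition then turns columns into rows, which are lowered in turn.
    The resulting minors are nonzero scalars at the identity matrix. *)
Lemma minor_mul_neq0 (k m : nat) (S T : {set 'I_k}) (J L : {set 'I_m}) :
  #|S| = #|J| -> #|T| = #|L| -> ~ vanishing S T J L.
Proof.
move=> cS cT v; have [S' [T' [iS iT cS' cT' v']]] := vanishing_initial cS cT v.
have vt : vanishing J L S' T'.
  move=> A x hx; rewrite -(minor_tr q0 hq hx (esym cS')) -(minor_tr q0 hq hx (esym cT')).
  by apply: v'; exact: qmat_rel_tr.
have [J' [L' [iJ iL cJ cL v'']]] := vanishing_initial (esym cS') (esym cT') vt.
have [hx n1] := minor_identity cJ iJ iS; have [_ n2] := minor_identity cL iL iT.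
by have /eqP := v'' _ _ hx; apply/negP; rewrite mulf_neq0.
Qed.
End Nonvanishing.

(** * Weakly separated pairs *)

Section WeakSeparation.
Variables (k m : nat).
Implicit Types (A C : {set 'I_k}) (B D : {set 'I_m}).

Lemma Sset_rshift A B (b : 'I_m) : (rshift k b \in Sset A B) = (b \in B).
Proof.
rewrite inE (mem_imset _ _ (@rshift_inj _ _)) orbC.
case: imsetP => //= -[a _ /eqP]; by rewrite eq_sym eq_lrshift.
Qed.

Lemma Sset_lshift A B (a : 'I_k) : (lshift m (rev_ord a) \in Sset A B) = (a \notin A).
Proof.
rewrite inE (mem_imset _ _ (@lshift_inj _ _)) inE (mem_imset _ _ rev_ord_inj).
by case: imsetP => //= -[b _ /eqP]; rewrite eq_lrshift.
Qed.

Lemma card_ord_add (J : {set 'I_(k + m)}) :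
  #|J| = (#|[set b | rshift k b \in J]| + #|[set a | lshift m (rev_ord a) \in J]|)%N.
Proof.
rewrite -(card_imset _ (@rshift_inj k m)).
rewrite -(card_imset [set a | _] (inj_comp (@lshift_inj k m) rev_ord_inj)).
set X := [set _ | _ in _]; set Y := [set _ | _ in _].
have e0 : X :&: Y = set0.
  apply/setP => i; rewrite !inE; apply/negbTE/negP => /andP[/imsetP[b _ ->] /imsetP[a _ /eqP]].
  by rewrite eq_sym eq_lrshift.
rewrite -cardsUI e0 cards0 addn0.
apply: eq_card => i; rewrite inE; apply/idP/orP => [iJ|[]/imsetP[a]]; last first.
- by rewrite inE => ? ->.
- by rewrite inE => ? ->.
case: (split_ordP i) iJ => j -> jJ; [right|left]; apply/imsetP.
  by exists (rev_ord j); rewrite ?inE /= rev_ordK.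
by exists j; rewrite ?inE.
Qed.
End WeakSeparation.

(** * Commutation of the minors of a weakly separated pair *)

Section Commutation.
Variables (K : fieldType) (q : K).
Hypothesis q0 : q != 0.
Hypothesis hq : forall n, (0 < n)%N -> q ^+ n != 1.

(** Two natural exponents are kept because both exchange lemmas carry a power of [q] on each side;
    only their difference matters. *)
Lemma weak_sep_minor_comm (E : algType K) (k m : nat) (x : 'I_k -> 'I_m -> E)
    (A C : {set 'I_k}) (B D : {set 'I_m}) (J' J'' : {set 'I_(k + m)}) :
  qmat_rel q x -> #|A| = #|B| -> #|C| = #|D| ->
  weak_sep_split (Sset A B) (Sset C D) J' J'' ->
  exists n1 n2 : nat,
    q ^+ n1 *: (minor q x C D * minor q x A B) = q ^+ n2 *: (minor q x A B * minor q x C D) /\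
    (#|J''| + #|A| + n1 = #|J'| + #|C| + n2)%N.
Proof.
move=> hx cA cC [_ eJ dJ p1 p2].
(* The indices 1 and 2 refer to [J'] and [J'']. Complementation turns the row part into [A :\: C],
   and [rev_ord] reverses the order: [A1] lies above [C :\: A], and [A2] below it. *)
pose D1 := [set b | rshift k b \in J']; pose D2 := [set b | rshift k b \in J''].
pose A1 := [set a | lshift m (rev_ord a) \in J'];
  pose A2 := [set a | lshift m (rev_ord a) \in J''].
have c1 : #|J'| = (#|D1| + #|A1|)%N by exact: card_ord_add.
have c2 : #|J''| = (#|D2| + #|A2|)%N by exact: card_ord_add.
have mD (b : 'I_m) : (b \in D) && (b \notin B) = (b \in D1) || (b \in D2).
  have /setP/(_ (rshift k b)) := eJ.
  by rewrite in_setD in_setU !Sset_rshift andbC [b \in D1]inE [b \in D2]inE.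
have mA (a : 'I_k) : (a \in A) && (a \notin C) = (a \in A1) || (a \in A2).
  have /setP/(_ (lshift m (rev_ord a))) := eJ.
  by rewrite in_setD in_setU !Sset_lshift negbK [a \in A1]inE [a \in A2]inE.
have BD1 (b d : 'I_m) : b \in B -> b \notin D -> d \in D1 -> (d < b)%N.
  rewrite inE => bB bD h; have := p1 _ (rshift k b) h.
  by rewrite in_setD !Sset_rshift bB bD /= ltn_add2l; apply.
have BD2 (b d : 'I_m) : b \in B -> b \notin D -> d \in D2 -> (b < d)%N.
  rewrite inE => bB bD h; have := p2 (rshift k b) _ _ h.
  by rewrite in_setD !Sset_rshift bB bD /= ltn_add2l; apply.
have CA1 (c a : 'I_k) : c \in C -> c \notin A -> a \in A1 -> (c < a)%N.
  rewrite inE => cC' cA' h; have := p1 _ (lshift m (rev_ord c)) h.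
  rewrite in_setD !Sset_lshift negbK cC' cA' /= => /(_ isT).
  by have := ltn_ord a; have := ltn_ord c; clear; lia.
have CA2 (c a : 'I_k) : c \in C -> c \notin A -> a \in A2 -> (a < c)%N.
  rewrite inE => cC' cA' h; have := p2 (lshift m (rev_ord c)) _ _ h.
  rewrite in_setD !Sset_lshift negbK cC' cA' /= => /(_ isT).
  by have := ltn_ord a; have := ltn_ord c; clear; lia.
have CD1 (c : 'I_k) (d : 'I_m) : c \in C -> c \notin A -> d \in D1 -> False.
  rewrite inE => cC' cA' h; have := p1 _ (lshift m (rev_ord c)) h.
  rewrite in_setD !Sset_lshift negbK cC' cA' /= => /(_ isT).
  by have := ltn_ord c; clear; lia.
have BA2 (b : 'I_m) (a : 'I_k) : b \in B -> b \notin D -> a \in A2 -> False.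
  rewrite inE => bB bD h; have := p2 (rshift k b) _ _ h.
  rewrite in_setD !Sset_rshift bB bD /= => /(_ isT).
  by have := ltn_ord a; clear; lia.
have dis (i : 'I_(k + m)) : i \in J' -> i \in J'' -> False.
  by move=> i1 i2; have := disjointFr dJ i1; rewrite i2.
have cAC : (#|A| - #|A :&: C| = #|A1| + #|A2|)%N.
  rewrite -cardsD -cardsUI [A1 :&: A2](_ : _ = set0) ?cards0 ?addn0.
    by apply: eq_card => a; rewrite in_setU -mA in_setD andbC.
  by apply/setP => a; rewrite !inE; apply/negP => /andP[]; exact: dis.
have cDB : (#|D| - #|D :&: B| = #|D1| + #|D2|)%N.
  rewrite -cardsD -cardsUI [D1 :&: D2](_ : _ = set0) ?cards0 ?addn0.
    by apply: eq_card => b; rewrite in_setU -mD in_setD andbC.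
  by apply/setP => b; rewrite !inE; apply/negP => /andP[]; exact: dis.
have lAC : (#|A :&: C| <= #|A|)%N by rewrite subset_leq_card ?subsetIl.
have lDB : (#|D :&: B| <= #|D|)%N by rewrite subset_leq_card ?subsetIl.
case: (boolP (C \subset A)) => [sCA|/subsetPn[c0 c0C c0A]].
  have eAC : A :&: C = C by exact/setIidPr.
  case: (boolP (B \subset D)) => [sBD|/subsetPn[b0 b0B b0D]].
    have eDB : D :&: B = B by exact/setIidPr.
    (* Both inclusions force A = C and B = D by counting, and the two minors coincide. *)
    exists 0, 0; split.
      have eB : B = D by apply/eqP; rewrite eqEcard sBD -cC -cA subset_leq_card.
      have eA : C = A by apply/eqP; rewrite eqEcard sCA cC cA -eB leqnn.
      by move: cA cC; rewrite -eB eA.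
    by move: cAC cDB lAC lDB; rewrite eAC eDB c1 c2 cA cC; clear; lia.
  have A20 : #|A2| = 0.
    by apply: eq_card0 => a; apply/negP => h; exact: (BA2 b0 a).
  (* After transposition [D] is the row set to be split; the cut [b0] lies above [D1] and below
     [D2]. *)
  have hxt := qmat_rel_tr hx.
  have := minor_straddle q0 (p := b0) hxt (esym cC) (esym cA) sCA.
  rewrite !(minor_tr q0 hq hx) // => h.
  exists #|D1|, #|D2|; split; last first.
    by move: cAC cDB lAC lDB; rewrite eAC c1 c2 cA cC A20; clear; lia.
  have e1 : [set j in D :\: B | (b0 <= j)%N] = D2.
    apply/setP => j; rewrite inE in_setD andbC (andbC (_ \notin _)) mD orbC.
    case: (boolP (j \in D2)) => [/(BD2 b0 j b0B b0D)/ltnW -> //|_] /=.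
    by case: (boolP (j \in D1)) => [/(BD1 b0 j b0B b0D) lt|_];
      [rewrite leqNgt lt|rewrite andbF].
  have e2 : [set j in D :\: B | (j < b0)%N] = D1.
    apply/setP => j; rewrite inE in_setD andbC (andbC (_ \notin _)) mD.
    case: (boolP (j \in D1)) => [/(BD1 b0 j b0B b0D) -> //|_] /=.
    by case: (boolP (j \in D2)) => [/(BD2 b0 j b0B b0D)/ltnW le|_];
      [rewrite ltnNge le|rewrite andbF].
  rewrite e1 e2 in h; apply/esym; apply: h => i j; rewrite !in_setD => /andP[iD iB];
    rewrite andbC mD => /orP[] jd jb.
  - by have := BD1 b0 j b0B b0D jd; rewrite ltnNge jb.
  - exact: BD2.
  - exact: BD1.
  - by have := BD2 b0 j b0B b0D jd; rewrite ltnNge (ltnW jb).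
case: (boolP (B \subset D)) => [sBD|/subsetPn[b0 b0B b0D]].
  have eDB : D :&: B = B by exact/setIidPr.
  have D10 : #|D1| = 0.
    by apply: eq_card0 => d; apply/negP => h; exact: (CD1 c0 d).
  (* The cut [c0] lies above [A2] and below [A1]. *)
  have h := minor_straddle q0 (p := c0) hx cA cC sBD.
  exists #|A1|, #|A2|; split; last first.
    by move: cAC cDB lAC lDB; rewrite eDB c1 c2 cA cC D10; clear; lia.
  have e1 : [set j in A :\: C | (c0 <= j)%N] = A1.
    apply/setP => j; rewrite inE in_setD andbC (andbC (_ \notin _)) mA.
    case: (boolP (j \in A1)) => [/(CA1 c0 j c0C c0A)/ltnW -> //|_] /=.
    by case: (boolP (j \in A2)) => [/(CA2 c0 j c0C c0A) lt|_];
      [rewrite leqNgt lt|rewrite andbF].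
  have e2 : [set j in A :\: C | (j < c0)%N] = A2.
    apply/setP => j; rewrite inE in_setD andbC (andbC (_ \notin _)) mA orbC.
    case: (boolP (j \in A2)) => [/(CA2 c0 j c0C c0A) -> //|_] /=.
    by case: (boolP (j \in A1)) => [/(CA1 c0 j c0C c0A)/ltnW le|_];
      [rewrite ltnNge le|rewrite andbF].
  rewrite e1 e2 in h; apply: h => i j; rewrite !in_setD => /andP[iA iC];
    rewrite andbC mA => /orP[] ja jc.
  - exact: CA1.
  - by have := CA2 c0 j c0C c0A ja; rewrite ltnNge jc.
  - by have := CA1 c0 j c0C c0A ja; rewrite ltnNge (ltnW jc).
  - exact: CA2.
have D10 : #|D1| = 0.
  by apply: eq_card0 => d; apply/negP => h; exact: (CD1 c0 d).
have A20 : #|A2| = 0.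
  by apply: eq_card0 => a; apply/negP => h; exact: (BA2 b0 a).
(* Now [A :\: C] is [A1], above [C :\: A], and [D :\: B] is [D2], above [B :\: D]: the situation of
   [minor_exchange]. *)
exists #|D :&: B|, #|A :&: C|; split; last first.
  by move: cAC cDB lAC lDB; rewrite c1 c2 cA cC D10 A20; clear; lia.
apply/esym; rewrite (setIC A C); apply: (@minor_exchange _ _ q0 E k m x C A D B) => // i j.
  rewrite !in_setD => /andP[iA iC]; rewrite andbC mA => /orP[ja|/(BA2 _ _ b0B b0D)//].
  exact: CA1.
rewrite !in_setD => /andP[iD iB]; rewrite andbC mD => /orP[/(CD1 _ _ c0C c0A)//|].
exact: BD2.
Qed.
End Commutation.

(** * Passage to the presented algebra and uniqueness of the exponent *)

Section Lift.
Variables (K : fieldType) (q : K) (k m : nat) (A : algType K) (x : 'I_k -> 'I_m -> A).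
Hypothesis hx : qmat_rel q x.

Lemma qmat_lift_minor (I : {set 'I_k}) (J : {set 'I_m}) :
  qmat_lift x (minor q (@qgen K q k m) I J) = minor q x I J.
Proof.
have l0 : qmat_lift (q := q) x 0 = 0.
  by rewrite -[0 in LHS](scale0r 0) qmat_liftZ // scale0r.
rewrite /minor; case: eqP => [e|_]; last exact: l0.
rewrite /gminor (big_morph _ (qmat_liftD hx) l0); apply: eq_bigr => s _.
rewrite qmat_liftZ //; congr (_ *: _).
rewrite (big_morph _ (qmat_liftM hx) (qmat_lift1 hx)); apply: eq_bigr => r _.
exact: qmat_lift_gen.
Qed.
End Lift.

Lemma qvar_neq0 (F : fieldType) : (tofrac 'X : {fraction {poly F}}) != 0.
Proof. by rewrite tofrac_eq0 polyX_eq0. Qed.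

Lemma qvar_expn_neq1 (F : fieldType) n : (0 < n)%N -> (tofrac 'X : {fraction {poly F}}) ^+ n
  != 1.
Proof.
move=> n0; rewrite -rmorphXn -tofrac1 tofrac_eq;
  apply/eqP => /(congr1 (fun p : {poly F} => size p)).
by rewrite size_polyXn size_poly1 => -[] /eqP; rewrite eqn0Ngt n0.
Qed.

Lemma expfz_inj (K : fieldType) (q : K) :
  q != 0 -> (forall n, (0 < n)%N -> q ^+ n != 1) -> injective (fun c : int => q ^ c).
Proof.
move=> q0 hq c d /= e; apply/eqP; rewrite -subr_eq0; apply/eqP.
have : q ^ (c - d) = 1 by rewrite expfzDr // -invr_expz e divff // expfz_neq0.
case: (c - d) => [[//|n]|n] /eqP.
  by rewrite -exprnP (negPf (hq n.+1 isT)).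
by rewrite NegzE -invr_expz invr_eq1 -exprnP (negPf (hq n.+1 isT)).
Qed.

Lemma scale_expz (K : fieldType) (q : K) (V : lmodType K) (a b : nat) (u v : V) :
  q != 0 -> q ^+ a *: u = q ^+ b *: v -> u = q ^ (b%:Z - a%:Z) *: v.
Proof.
move=> q0 e; apply: (scalerI (expf_neq0 a q0)); rewrite e scalerA; congr (_ *: _).
by rewrite (exprnP q a) -expfzDr // addrC subrK.
Qed.

Theorem theorem2 (R : realType) (k m : nat) (hk : (1 <= k)%N) (hkm : (k <= m)%N)
  (A C : {set 'I_k}) (B D : {set 'I_m})
  (hA : A != set0) (hB : B != set0) (hC : C != set0) (hD : D != set0)
  (hAB : #|A| = #|B|) (hCD : #|C| = #|D|)
  (J' J'' : {set 'I_(k + m)})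
  (hws : weakly_separated (Sset A B) (Sset C D))
  (hsplit : weak_sep_split (Sset A B) (Sset C D) J' J'') :
  unique
    (fun c : int => qcomm_exponent (qvar R) (qminor (qvar R) hAB) (qminor (qvar R) hCD) c)
    (#|J''|%:Z - #|J'|%:Z + #|A|%:Z - #|C|%:Z).
Proof.
have q0 := qvar_neq0 R[i]; have hq := @qvar_expn_neq1 R[i].
set q := qvar R in q0 hq *.
have -> : qminor q hAB = minor q (@qgen _ q k m) A B by rewrite (minorE _ _ hAB).
have -> : qminor q hCD = minor q (@qgen _ q k m) C D by rewrite (minorE _ _ hCD).
set X := minor _ _ A B; set Y := minor _ _ C D.
(* If the product were zero in the presented algebra, lifting would make it zero in every algebra
   with the relations. *)
have nXY : X * Y != 0.
  apply/eqP => XY; apply: (minor_mul_neq0 q0 hq hAB hCD) => E x hx.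
  rewrite -!(qmat_lift_minor hx) -(qmat_liftM hx) -/X -/Y XY.
  by rewrite -[0 in LHS](scale0r 0) (qmat_liftZ hx) scale0r.
have ex : qcomm_exponent q X Y (#|J''|%:Z - #|J'|%:Z + #|A|%:Z - #|C|%:Z).
  have [n1 [n2 [e en]]] := weak_sep_minor_comm q0 hq (qgen_rel q k m) hAB hCD hsplit.
  rewrite /qcomm_exponent (_ : _ - _ = n2%:Z - n1%:Z); last by lia.
  exact: scale_expz e.
(* Two exponents give a scalar multiple of [X * Y] equal to 0, hence equal powers of [q], which is
   not a root of unity. *)
split=> // c ec; apply: (expfz_inj q0 hq).
move: ec; rewrite /qcomm_exponent ex => /eqP.
rewrite -subr_eq0 -scalerBl scaler_eq0 (negPf nXY) orbF subr_eq0.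
by move/eqP.
Qed.
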